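(* The value function $v$ of the optimal information acquisition problem is the unique solution, within the set $\mathbb{V}$ of candidate value functions, of the recursive (Bellman) equation \[ v(p) = \sup_{\tau \geq 0} \Biggl[ \int_0^\tau e^{-rt} u(p_t)\, dt + e^{-r \tau} \Biggl( \sup_{F \in \mathcal{B}(p_\tau)} \int_{\Delta(\Theta)} v\, dF - C(F) - \kappa \Biggr) \Biggr], \] where $p_t = e^{-\lambda t}p + (1-e^{-\lambda t})\pi$ is the deterministic belief path starting from $p_0=p$.
   Context: A decision maker (DM) takes an action at every instant $t\ge 0$; the unobserved state $\theta_t\in\Theta=\{0,1\}$ follows a Markov chain jumping $0\to1$ at rate $\lambda_0>0$ and $1\to0$ at rate $\lambda_1>0$; let $\lambda=\lambda_0+\lambda_1$ and $\pi=\lambda_0/(\lambda_0+\lambda_1)$. Beliefs are identified with $p\in[0,1]$ (probability that $\theta=1$). The indirect flow utility $u:\Delta(\Theta)\to\mathbb{R}$, $u(p)=\max_{a\in A}\mathbb{E}_{\theta\sim p}[\tilde u(a,\theta)]$, is continuous. The DM chooses an information acquisition policy $\{\tau_i,F_i\}_{i\in\mathbb{N}}$: increasing (random) acquisition times $\tau_i$ with $\tau_0=0$, and distributions over posteriors $F_i$ that are Bayes plausible with respect to the current belief, i.e. $F_i\in\mathcal{B}(P_{\tau_i^-})$ where $\mathcal{B}(p):=\{F\in\Delta\Delta(\Theta): \int q\,dF(q)=p\}$; between acquisition times beliefs drift deterministically, $dp_t=\lambda(\pi-p_t)dt$, and at $\tau_i$ a new belief is drawn from $F_i$. Each acquisition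 costs $C(F_i)+\kappa$ with fixed cost $\kappa>0$ and uniformly posterior separable variable cost $C(F)=\int (c(q)-c(p))\,dF(q)$, $p=\int q\,dF(q)$, for a convex $c:\Delta(\Theta)\to\overline{\mathbb{R}}_+$ that is finite and continuously differentiable on the interior. With discount rate $r>0$, the value function is $v(p):=\sup_{\{\tau_i,F_i\},\,F_0\in\mathcal{B}(p)}\mathbb{E}\bigl[\int_0^\infty e^{-rt}u(P_t)\,dt-\sum_{i\ge0}e^{-r\tau_i}(C(F_i)+\kappa)\bigr]$. Define $\overline v(p):=\int_0^\infty e^{-rt}\mathbb{E}_{\theta\sim p_t}[\max_a \tilde u(a,\theta)]\,dt$ (value under perfect costless observation of the state) and $\underline v(p):=\int_0^\infty e^{-rt}u(p_t)\,dt$ (value with no information). The set $\mathbb{V}$ of candidate value functions is the set of real-valued bounded measurable functions on $\Delta(\Theta)$ lying pointwise between $\underline v$ and $\overline v$.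
   Formalization: The first acquisition time τ_0 is any time in [0,∞] (possibly never), with F_0 plausible for the drifted belief, rather than forced at τ_0=0 at cost κ, which would make the claim false; acquisition times tend to infinity, and C(F)=0 where c(p)=∞ at an endpoint belief. *)

(* Defs.v *)
From HB Require Import structures.
From mathcomp Require Import all_boot all_order all_algebra.
From mathcomp Require Import all_classical all_reals all_analysis measurable_realfun.
Import Order.TTheory GRing.Theory Num.Theory.
Import numFieldNormedType.Exports.

Set Implicit Arguments.
Unset Strict Implicit.
Unset Printing Implicit Defensive.

Local Open Scope classical_set_scope.
Local Open Scope ring_scope.

(* Beliefs p \in [0,1] = probability that theta = 1 (theta : bool, true = 1). *)

Section Model.
Context {R : realType}.
Variables (lam0 lam1 r kappa : R) (A : Type) (ut : A -> bool -> R)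
  (c : R -> \bar R).

Definition lam : R := lam0 + lam1.
Definition pi_st : R := lam0 / lam.

Definition bpath (p t : R) : R :=
  expR (- lam * t) * p + (1 - expR (- lam * t)) * pi_st.

Definition expected_ut (p : R) (a : A) : R :=
  (1 - p) * ut a false + p * ut a true.

Definition u (p : R) : R := sup [set expected_ut p a | a in [set: A]].

Definition umax (th : bool) : R := sup [set ut a th | a in [set: A]].

(* value with no information *)
Definition vlow (p : R) : \bar R :=
  (\int[lebesgue_measure]_(t in `[0%R, +oo[%classic)
     (expR (- r * t) * u (bpath p t))%:E)%E.

(* value under perfect costless observation of the state *)
Definition vbar (p : R) : \bar R :=
  (\int[lebesgue_measure]_(t in `[0%R, +oo[%classic)
     (expR (- r * t) * ((1 - bpath p t) * umax false
                         + bpath p t * umax true))%:E)%E.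

Definition inB (q : R) (F : probability R R) : Prop :=
  F `[0%R, 1%R]%classic = 1%E /\
  (\int[F]_(x in `[0%R, 1%R]%classic) x%:E)%E = q%:E.

(* uniformly posterior separable cost C(F) = int (c x - c q) dF(x);
   convention C(F) = 0 when c q = +oo (then q is a boundary point and
   F = delta_q is the only Bayes-plausible distribution). *)
Definition Ccost (q : R) (F : probability R R) : \bar R :=
  if c q \is a fin_num then (\int[F]_(x in `[0%R, 1%R]%classic) (c x - c q))%E
  else 0%E.

Definition inV (w : R -> R) : Prop :=
  measurable_fun (`[0%R, 1%R]%classic : set R) w /\
  (exists M : R, forall p, p \in `[0, 1] -> `|w p| <= M) /\
  (forall p, p \in `[0, 1] -> (vlow p <= (w p)%:E <= vbar p)%E).

Definition inner (w : R -> R) (q : R) : \bar R :=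
  ereal_sup [set ((\int[F]_(x in `[0%R, 1%R]%classic) (w x)%:E)
                   - Ccost q F - kappa%:E)%E | F in inB q].

Definition bellman_rhs (w : R -> R) (p : R) : \bar R :=
  ereal_sup [set ((\int[lebesgue_measure]_(t in `[0%R, tau]%classic)
                     (expR (- r * t) * u (bpath p t))%:E)
                  + (expR (- r * tau))%:E * inner w (bpath p tau))%E
            | tau in `[0%R, +oo[%classic].

Definition solves_bellman (w : R -> R) : Prop :=
  forall p, p \in `[0, 1] -> (w p)%:E = bellman_rhs w p.

Section Policy.
Context {d : measure_display} {Om : measurableType d}.
Variables (P : probability Om R) (tau : nat -> Om -> \bar R)
  (Q : nat -> Om -> R) (F : nat -> Om -> probability R R) (p : R).
(* tau i = time of the i-th acquisition (+oo = never);
   Q i = posterior drawn at tau i;  F i = distribution chosen at tau i. *)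

(* belief just before the i-th acquisition, P_{tau_i^-} *)
Definition prior (i : nat) (w : Om) : R :=
  match i with
  | 0 => bpath p (fine (tau 0 w))
  | k.+1 => bpath (Q k w) (fine (tau k.+1 w) - fine (tau k w))
  end.

(* information available when F_i is chosen: tau_0..tau_i, Q_0..Q_{i-1} *)
Definition history_gen (i : nat) : set (set Om) :=
  [set E | exists j (B : set (\bar R)), (j <= i)%N /\ measurable B /\
                                       E = tau j @^-1` B] `|`
  [set E | exists j (B : set R), (j < i)%N /\ measurable B /\
                                 E = Q j @^-1` B].

Definition history (i : nat) : set (set Om) := <<s history_gen i >>.

Definition admissible : Prop :=
  (forall i, measurable_fun [set: Om] (tau i)) /\
      (forall i, measurable_fun [set: Om] (Q i)) /\
      (forall w, (0 <= tau 0 w)%E) /\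
      (forall i w, (tau i w <= tau i.+1 w)%E /\
                   ((tau i w < +oo)%E -> (tau i w < tau i.+1 w)%E)) /\
      (forall w (T : R), exists i, (T%:E < tau i w)%E) /\
      (forall i w, 0 <= Q i w <= 1) /\
      (forall i w, (tau i w < +oo)%E -> inB (prior i w) (F i w)) /\
      (forall i (B : set R), measurable B -> forall Y : set (\bar R),
          measurable Y -> history i ((fun w => F i w B) @^-1` Y)) /\
      (forall i (E : set Om) (B : set R), history i E -> measurable B ->
          P (E `&` [set w | (tau i w < +oo)%E] `&` Q i @^-1` B) =
          (\int[P]_(w in E `&` [set w | (tau i w < +oo)%E]) F i w B)%E).

(* discounted flow utility int_0^oo e^{-rt} u(P_t) dt, pathwise *)
Definition flow (w : Om) : \bar R :=
  ((\int[lebesgue_measure]_(t in [set t : R | (0 <= t)%R /\ (t%:E < tau 0 w)%E])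
      (expR (- r * t) * u (bpath p t))%:E)
   + \sum_(i <oo)
       \int[lebesgue_measure]_(t in [set t : R |
                              (tau i w <= t%:E)%E /\ (t%:E < tau i.+1 w)%E])
         (expR (- r * t) * u (bpath (Q i w) (t - fine (tau i w))))%:E)%E.

Definition costs (w : Om) : \bar R :=
  (\sum_(i <oo)
     (if (tau i w < +oo)%E
      then (expR (- r * fine (tau i w)))%:E
             * (Ccost (prior i w) (F i w) + kappa%:E)
      else 0))%E.

Definition payoff : \bar R :=
  (\int[P]_w flow w - \int[P]_w costs w)%E.

End Policy.

Definition value (p : R) : \bar R :=
  ereal_sup [set J | exists (d : measure_display) (Om : measurableType d)
     (P : probability Om R) (tau : nat -> Om -> \bar R) (Q : nat -> Om -> R)
     (F : nat -> Om -> probability R R),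
     admissible P tau Q F p /\ J = payoff P tau Q F p].

End Model.

(* Main.v *)
Require Import Defs.
From HB Require Import structures.
From mathcomp Require Import finmap.
From mathcomp Require Import all_boot all_order all_algebra.
From mathcomp Require Import all_classical all_reals all_analysis measurable_realfun.
From mathcomp Require Import ring lra.
Import Order.TTheory GRing.Theory Num.Theory.
Import numFieldNormedType.Exports.
Local Open Scope classical_set_scope.
Local Open Scope ring_scope.

(** Call [z] superharmonic if it dominates the no-information value and the payoff
    of every plan "wait [s], draw a two-point lottery on [{x, y}], then collect
    [z]". The pointwise infimum [vstar] of the superharmonic functions is again
    superharmonic, and it is minimal, which makes it lower semicontinuous and a
    solution of the Bellman equation: by concavification, two-point lotteries do
    as well as arbitrary Bayes plausible distributions, and waiting one more
    instant avoids the endpoints where [c] may be infinite.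

    Uniqueness is a contraction argument: any solution in [V] is superharmonic,
    hence above [vstar]; and since the fixed cost makes the Bellman operator map
    [vbar + kappa] below [vbar], a bound of the solution by
    [vstar + a (vbar + kappa - vstar)] improves by a constant factor in [a].

    The value is at most [vstar] because along any admissible policy the
    discounted value [vstar] decreases in expectation, by disintegration of each
    posterior with respect to the history; nonnegativity is obtained by adding a
    constant to the flow payoff. It is at least [vstar] because the supremum of
    the payoffs of finite policies living on the countable space [nat] is itself
    superharmonic: policies started at [x] and [y] are glued on the even and the
    odd integers. *)

Set Implicit Arguments.
Unset Strict Implicit.
Unset Printing Implicit Defensive.

(** * Belief paths and discounted flows *)

(** The usual dynamic programming argument selects near-optimal continuation policies measurably and
    needs a measurable value in advance. Testing only two-point lotteries avoids both:
    [superharmonic] reads [z] at two posteriors, asks for no measurability, and therefore survives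
    infima and a change at a single point; and gluing requires only two near-optimal continuations
    at a time, on [nat], where every function is measurable. Measurability of [vstar] then comes out
    of minimality.

    Discounting alone gives no contraction, because the waiting time in the Bellman equation may be
    0; the rate obtained is [1 - kappa / B], where [B] bounds the gap [vb + kappa - vstar].

    Costs may be infinite and need not be measurable along a policy. The verification therefore
    works with sums of nonnegative terms and keeps costs on the larger side of each inequality, so
    that no infinite quantity is subtracted before the last step. *)

Section integral_translation.
Context {R : realType}.
Local Notation mu := (@lebesgue_measure R).

Lemma lebesgue_measure_translation (a : R) (A : set R) : measurable A ->
  pushforward mu ((fun x => x + a) : measurableTypeR R -> measurableTypeR R) A
  = mu A.
Proof.
have ma : measurable_fun setT
  ((fun x => x + a) : measurableTypeR R -> measurableTypeR R).
  by apply: measurable_funD => //; exact: measurable_id.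
pose h : {mfun measurableTypeR R >-> measurableTypeR R} :=
  HB.pack (fun x : measurableTypeR R => (x + a : measurableTypeR R))
    (isMeasurableFun.Build _ _ _ _ _ ma).
move=> mA; apply/esym/(@lebesgue_measure_unique R (pushforward mu h)) => //=.
move=> _ [[b c] /= bc <-].
rewrite /pushforward/=.
have -> : (fun x : R => x + a) @^-1` `]b, c] = `]b - a, c - a]%classic.
  by apply/seteqP; split => x /=; rewrite !in_itv/= ltrBlDr lerBrDr.
rewrite !lebesgue_measure_itv/= !lte_fin ltrD2r.
by case: ifP => // _; rewrite -!EFinB; congr EFin; ring.
Qed.

(** No integrability is asked for: the pushforward formula is applied to the positive and negative
    parts separately. *)
Lemma integral_translation (a : R) (D : set R) (f : R -> \bar R) :
  measurable D -> measurable_fun D f ->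
  (\int[mu]_(x in D) f x = \int[mu]_(x in [set x | D (x + a)%R]) f (x + a)%R)%E.
Proof.
move=> mD mf.
have ma : measurable_fun setT
  ((fun x => x + a) : measurableTypeR R -> measurableTypeR R).
  by apply: measurable_funD => //; exact: measurable_id.
pose h : {mfun measurableTypeR R >-> measurableTypeR R} :=
  HB.pack (fun x : measurableTypeR R => (x + a : measurableTypeR R))
    (isMeasurableFun.Build _ _ _ _ _ ma).
have ge0 g : measurable_fun D g -> (forall x, (0 <= g x)%E) ->
  (\int[mu]_(x in D) g x = \int[mu]_(x in [set x | D (x + a)%R]) g (x + a)%R)%E.
  move=> mg g0.
  rewrite -[LHS](@eq_measure_integral _ _ _ _ _ (pushforward mu h)); last first.
    by move=> A mA _; exact: (lebesgue_measure_translation a mA).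
  by rewrite (@ge0_integral_pushforward _ _ _ _ _ h).
rewrite integralE [RHS]integralE !ge0//; last 2 first.
- exact: measurable_funeneg.
- exact: measurable_funepos.
by congr (_ - _)%E; apply: eq_integral => x _; rewrite ?funeposE ?funenegE.
Qed.

End integral_translation.

Section integrable_EFin.
Context d (T : measurableType d) (R : realType).
Variables (m : {measure set T -> \bar R}) (D : set T).
Hypothesis mD : measurable D.

Lemma integrable_EFinZl (k : R) (f : T -> R) : m.-integrable D (EFin \o f) ->
  m.-integrable D (EFin \o (fun x => k * f x)).
Proof.
by move=> fi; apply: (eq_integrable mD _ _ _ (integrableZl mD k fi)).
Qed.

Lemma integrable_EFinD (f g : T -> R) : m.-integrable D (EFin \o f) ->
  m.-integrable D (EFin \o g) -> m.-integrable D (EFin \o (fun x => f x + g x)).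
Proof.
by move=> fi gi; apply: (eq_integrable mD _ _ _ (integrableD mD fi gi)).
Qed.

Lemma integrable_EFinB (f g : T -> R) : m.-integrable D (EFin \o f) ->
  m.-integrable D (EFin \o g) -> m.-integrable D (EFin \o (fun x => f x - g x)).
Proof.
by move=> fi gi; apply: (eq_integrable mD _ _ _ (integrableB mD fi gi)).
Qed.

End integrable_EFin.

Section belief_path.
Context {R : realType}.
Variables (lam0 lam1 : R).
Hypotheses (lam0_gt0 : 0 < lam0) (lam1_gt0 : 0 < lam1).
Local Notation bpath := (bpath lam0 lam1).

Lemma pi_st_itv : 0 < pi_st lam0 lam1 < 1.
Proof.
rewrite /pi_st /lam divr_gt0 ?addr_gt0//=.
by rewrite ltr_pdivrMr ?addr_gt0// mul1r ltrDl.
Qed.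

Lemma bpath0 p : bpath p 0 = p.
Proof. by rewrite /bpath mulr0 expR0; ring. Qed.

Lemma bpathD p s t : bpath (bpath p s) t = bpath p (s + t).
Proof. by rewrite /bpath (mulrDr (- lam lam0 lam1)) expRD; ring. Qed.

Lemma expR_lam_itv t : 0 <= t -> 0 < expR (- lam lam0 lam1 * t) <= 1.
Proof.
move=> t0; rewrite expR_gt0/= -expR0 ler_expR mulNr oppr_le0 mulr_ge0//.
by rewrite /lam addr_ge0 ?ltW.
Qed.

Lemma bpath_itv p t : 0 <= t -> p \in `[0, 1] -> bpath p t \in `[0, 1].
Proof.
move=> /expR_lam_itv; rewrite !in_itv/= /bpath.
move: (expR _) pi_st_itv => e; move: (pi_st _ _) => q.
by move=> *; apply/andP; split; nra.
Qed.

Lemma bpath_itvoo p t : 0 < t -> p \in `[0, 1] -> bpath p t \in `]0, 1[.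
Proof.
move=> t0; rewrite !in_itv/= /bpath.
have : 0 < expR (- lam lam0 lam1 * t) < 1.
  by rewrite expR_gt0/= -expR0 ltr_expR mulNr oppr_lt0 mulr_gt0// /lam addr_gt0.
move: (expR _) pi_st_itv => e; move: (pi_st _ _) => q.
by move=> *; apply/andP; split; nra.
Qed.

Lemma bpath_dist p p' t : 0 <= t -> `|bpath p t - bpath p' t| <= `|p - p'|.
Proof.
move=> /expR_lam_itv /andP[e0 e1]; rewrite /bpath.
rewrite [X in `|X|](_ : _ = expR (- lam lam0 lam1 * t) * (p - p')); last by ring.
by rewrite normrM (ger0_norm (ltW e0)) ler_piMl.
Qed.

Lemma bpath_affine a p p' t :
  bpath (a * p + (1 - a) * p') t = a * bpath p t + (1 - a) * bpath p' t.
Proof. by rewrite /bpath; ring. Qed.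

Lemma continuous_bpath_time p : continuous (bpath p).
Proof.
move=> t; rewrite /bpath.
have ce : {for t, continuous (fun t => expR (- lam lam0 lam1 * t))}.
  apply: continuous_comp; last exact: continuous_expR.
  by apply: cvgM; [exact: cvg_cst|exact: cvg_id].
apply: cvgD; apply: cvgM; try exact: cvg_cst; first exact: ce.
by apply: cvgB; [exact: cvg_cst|exact: ce].
Qed.

Lemma continuous_bpath_belief t : continuous (bpath ^~ t).
Proof.
move=> p; rewrite /bpath; apply: cvgD; last exact: cvg_cst.
by apply: cvgM; [exact: cvg_cst|exact: cvg_id].
Qed.

End belief_path.

Section discounted_flow.
Context {R : realType}.
Variables (lam0 lam1 r : R).
Hypotheses (lam0_gt0 : 0 < lam0) (lam1_gt0 : 0 < lam1) (r_gt0 : 0 < r).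
Local Notation bpath := (bpath lam0 lam1).
Local Notation mu := (@lebesgue_measure R).

Lemma measurable_EFin_itvco (a b : \bar R) :
  measurable [set t : R | (a <= t%:E)%E /\ (t%:E < b)%E].
Proof.
rewrite [X in measurable X](_ : _ = setT `&` EFin @^-1` `[a, b[%classic).
  by apply: (@EFin_measurable R setT) => //; exact: emeasurable_itv.
by rewrite setTI; apply/seteqP; split => t /=; rewrite in_itv/=; [move=> [-> ->]|move=> /andP].
Qed.

(** Half-open at [tau], like the periods in [flow], so that consecutive periods partition the time
    axis. *)
Definition before (tau : \bar R) : set R := [set t | 0 <= t /\ (t%:E < tau)%E].

Definition disc (h : R -> R) (p : R) (tau : \bar R) : R :=
  \int[mu]_(t in before tau) (expR (- r * t) * h (bpath p t)).

Lemma before_fin (s : R) : before s%:E = `[0, s[%classic.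
Proof.
by apply/seteqP; split => t; rewrite /before/= in_itv/= lte_fin => /andP.
Qed.

Lemma before_pinfty : before +oo%E = `[0, +oo[%classic.
Proof.
apply/seteqP; split => t /=; rewrite in_itv/= ?andbT; first by case.
by move=> t0; split; rewrite ?ltry.
Qed.

Lemma before_ninfty : before -oo%E = set0.
Proof. by apply/seteqP; split => t //= [_]; rewrite ltNge leNye. Qed.

Lemma measurable_before tau : measurable (before tau : set (measurableTypeR R)).
Proof.
exact: (@measurable_EFin_itvco 0%E).
Qed.

Lemma continuous_disc_integrand h p : continuous h ->
  continuous (fun t => expR (- r * t) * h (bpath p t)).
Proof.
move=> ch t; apply: cvgM.
  apply: continuous_comp; last exact: continuous_expR.
  by apply: cvgM; [exact: cvg_cst|exact: cvg_id].
apply: continuous_comp; last exact: ch.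
exact: continuous_bpath_time.
Qed.

Lemma integral_expR_discount :
  (\int[mu]_(t in `[0%R, +oo[) (expR (- r * t))%:E = (r^-1)%:E)%E.
Proof.
have := integral_exponential_pdf r_gt0; rewrite /exponential_pdf.
rewrite (_ : (fun x => _) = (EFin \o (fun x => r * expR (- r * x))) \_ `[0%R, +oo[).
  2: by rewrite restrict_EFin.
rewrite -integral_mkcond.
under eq_integral do rewrite /= EFinM.
rewrite ge0_integralZl_EFin//; last 2 first.
- apply/measurable_EFinP; apply: measurable_funTS.
  apply: measurableT_comp; first exact: measurable_expR.
  by apply: measurable_funM => //; exact: measurable_id.
- exact: ltW.
move=> /(congr1 (fun x => (r^-1)%:E * x)%E).
by rewrite muleA -EFinM mulVf ?gt_eqF// mul1e mule1.
Qed.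

Lemma integrable_disc (h : R -> R) (K : R) p tau : continuous h -> (forall x, `|h x| <= K) ->
  mu.-integrable (before tau) (EFin \o (fun t => expR (- r * t) * h (bpath p t))).
Proof.
move=> ch hK.
have sub : before tau `<=` `[0, +oo[%classic.
  by move=> t [t0 _] /=; rewrite in_itv/= t0.
have me : measurable_fun setT (fun t : R => expR (- r * t)).
  apply: measurableT_comp; first exact: measurable_expR.
  by apply: measurable_funM => //; exact: measurable_id.
apply: (@integrableS _ _ _ mu `[0, +oo[%classic) => //.
  exact: measurable_before.
apply: (@le_integrable _ _ _ mu _ _ _ (fun t => K%:E * (expR (- r * t))%:E)%E) => //.
- apply/measurable_EFinP; apply: measurable_funTS.
  by apply: continuous_measurable_fun; exact: continuous_disc_integrand.
- move=> t _; rewrite -EFinM /= lee_fin !normrM mulrC.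
  by rewrite ler_wpM2r// (le_trans (hK _))// ler_norm.
apply: integrableZl => //; apply/integrableP; split.
  by apply/measurable_EFinP; exact: measurable_funTS.
under eq_integral do rewrite gee0_abs ?lee_fin ?expR_ge0//.
by rewrite integral_expR_discount ltry.
Qed.

Lemma integral_disc (h : R -> R) (K : R) p tau : continuous h -> (forall x, `|h x| <= K) ->
  (\int[mu]_(t in before tau) (expR (- r * t) * h (bpath p t))%:E
   = (disc h p tau)%:E)%E.
Proof.
move=> ch hK; rewrite /disc /Rintegral fineK//.
apply: (@integrable_fin_num _ _ _ mu); first exact: measurable_before.
exact: integrable_disc hK.
Qed.

Lemma integral_disc_translation (h : R -> R) (K : R) p a tau : continuous h ->
  (forall x, `|h x| <= K) ->
  (\int[mu]_(t in [set t : R | (a%:E <= t%:E) /\ (t%:E < a%:E + tau)])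
     (expR (- r * t) * h (bpath p (t - a)))%:E
   = (expR (- r * a) * disc h p tau)%:E)%E.
Proof.
move=> ch hK.
rewrite (@integral_translation _ a); last 2 first.
- exact: measurable_EFin_itvco.
- apply/measurable_EFinP; apply: measurable_funTS.
  apply: continuous_measurable_fun => t; apply: cvgM.
    apply: continuous_comp; last exact: continuous_expR.
    by apply: cvgM; [exact: cvg_cst|exact: cvg_id].
  apply: continuous_comp; last exact: ch.
  apply: continuous_comp; last exact: continuous_bpath_time.
  by apply: cvgB; [exact: cvg_id|exact: cvg_cst].
rewrite [X in integral _ X _](_ : _ = before tau); last first.
  apply/seteqP; split => t /=; rewrite lee_fin lerDr EFinD;
   move=> [t0]; rewrite addeC lteD2lE// => tt; split => //.
under eq_integral => t _ do
  rewrite addrK mulrDr expRD (mulrC (expR (- r * t))) -mulrA EFinM.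
rewrite integralZl//; last 2 first.
- exact: measurable_before.
- exact: integrable_disc hK.
by rewrite (integral_disc _ _ ch hK).
Qed.

Lemma discD (h : R -> R) (K : R) p s tau : continuous h -> (forall x, `|h x| <= K) ->
  0 <= s -> (0 <= tau)%E ->
  disc h p (s%:E + tau) = disc h p s%:E + expR (- r * s) * disc h (bpath p s) tau.
Proof.
move=> ch hK s0 tau0; apply: EFin_inj; rewrite EFinD.
rewrite -(integral_disc_translation _ _ _ ch hK) -!(integral_disc _ _ ch hK).
have -> : before (s%:E + tau) =
  before s%:E `|` [set t | (s%:E <= t%:E)%E /\ (t%:E < s%:E + tau)%E].
  apply/seteqP; split => t /=.
    by move=> [t0 tt]; have [ts|ts] := ltP (t%:E) s%:E; [left|right].
  move=> [[t0 ts]|[st tt]]; split => //.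
  - by apply: (lt_le_trans ts); rewrite leeDl.
  - by rewrite (le_trans s0)// -lee_fin.
rewrite [LHS]integral_setU; last 4 first.
- exact: measurable_before.
- exact: measurable_EFin_itvco.
- apply/measurable_EFinP; apply: measurable_funTS.
  by apply: continuous_measurable_fun; exact: continuous_disc_integrand.
- rewrite disj_set2E; apply/eqP/seteqP; split => t //= [[_ ts] [st _]].
  by move: (lt_le_trans ts st); rewrite ltxx.
congr (_ + _)%E; apply: eq_integral => t.
by rewrite inE/= => -[st _]; rewrite bpathD addrC subrK.
Qed.

Lemma disc_lin (h1 h2 : R -> R) (K1 K2 : R) a b p tau : continuous h1 -> continuous h2 ->
  (forall x, `|h1 x| <= K1) -> (forall x, `|h2 x| <= K2) ->
  disc (fun x => a * h1 x + b * h2 x) p tau = a * disc h1 p tau + b * disc h2 p tau.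
Proof.
move=> c1 c2 b1 b2; rewrite /disc.
have mt := measurable_before tau.
have i1 := integrable_disc p tau c1 b1; have i2 := integrable_disc p tau c2 b2.
rewrite -(RintegralZl _ mt i1) -(RintegralZl _ mt i2) -RintegralD//; last 2 first.
- exact: integrable_EFinZl.
- exact: integrable_EFinZl.
by apply: eq_Rintegral => t _; ring.
Qed.

Lemma le_disc (h1 h2 : R -> R) (K1 K2 : R) p tau : continuous h1 -> continuous h2 ->
  (forall x, `|h1 x| <= K1) -> (forall x, `|h2 x| <= K2) -> p \in `[0, 1] ->
  (forall q, q \in `[0, 1] -> h1 q <= h2 q) -> disc h1 p tau <= disc h2 p tau.
Proof.
move=> c1 c2 b1 b2 pI h12; apply: le_Rintegral.
- exact: measurable_before.
- exact: integrable_disc b1.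
- exact: integrable_disc b2.
- move=> t [t0 _]; rewrite ler_wpM2l ?expR_ge0// h12//.
  exact: bpath_itv.
Qed.

Lemma disc_one p : disc (fun=> 1) p +oo = r^-1.
Proof.
apply: EFin_inj; rewrite -(@integral_disc _ 1) ?normr1//; last first.
  by move=> x; exact: cvg_cst.
rewrite before_pinfty -integral_expR_discount.
by apply: eq_integral => t _; rewrite mulr1.
Qed.

Lemma disc_one_fin p s : 0 <= s -> disc (fun=> 1) p s%:E = (1 - expR (- r * s)) / r.
Proof.
(* The closed form comes from splitting the infinite horizon at [s]: both infinite-horizon terms are
   [r^-1]. *)
move=> s0; have := @discD (fun=> 1) 1 p s +oo%E.
rewrite addey// !disc_one => H; apply: (@addIr _ (expR (- r * s) / r)).
rewrite -H//.
- by field; rewrite gt_eqF.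
- by move=> x; exact: cvg_cst.
- by move=> _; rewrite normr1.
Qed.

Lemma disc_one_le p tau : 0 <= disc (fun=> 1) p tau <= r^-1.
Proof.
have c1 : continuous (fun _ : R => 1 : R) by move=> x; exact: cvg_cst.
have b1 : forall x : R, `|(1 : R)| <= 1 by move=> _; rewrite normr1.
apply/andP; split.
  by apply: Rintegral_ge0 => t _; rewrite mulr1 expR_ge0.
case: tau => [s||]; last 2 first.
- by rewrite disc_one.
- by rewrite /disc before_ninfty Rintegral_set0 invr_ge0 ltW.
have [s0|s0] := leP 0 s.
  by rewrite disc_one_fin// ler_pdivrMr// mulVf ?gt_eqF// gerBl expR_ge0.
rewrite /disc before_fin set_itv_ge ?Rintegral_set0 ?invr_ge0 ?ltW//.
by rewrite bnd_simp -leNgt ltW.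
Qed.

Lemma disc_bound (h : R -> R) (K : R) p tau : continuous h -> (forall x, `|h x| <= K) ->
  `|disc h p tau| <= K * disc (fun=> 1) p tau.
Proof.
move=> ch hK.
apply: (le_trans (le_normr_Rintegral (measurable_before tau) (integrable_disc p tau ch hK))).
have c1 : continuous (fun _ : R => 1 : R) by move=> x; exact: cvg_cst.
have b1 : forall x : R, `|(1 : R)| <= 1 by move=> _; rewrite normr1.
rewrite -RintegralZl; last 2 first.
- exact: measurable_before.
- exact: integrable_disc b1.
apply: le_Rintegral.
- exact: measurable_before.
- exact: integrable_norm (integrable_disc p tau ch hK).
- apply: integrable_EFinZl; first exact: measurable_before.
  exact: integrable_disc b1.
- move=> t [t0 _]; rewrite normrM ger0_norm ?expR_ge0// mulr1 mulrC.
  by rewrite ler_wpM2r ?expR_ge0.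
Qed.

(** Two belief paths never move apart ([bpath_dist]), so the Lipschitz constant of the flow is only
    multiplied by the total discount mass, at most [r^-1]. *)
Lemma disc_dist (h : R -> R) (K L : R) p p' tau : continuous h -> (forall x, `|h x| <= K) ->
  0 <= L -> (forall x y, `|h x - h y| <= L * `|x - y|) ->
  `|disc h p tau - disc h p' tau| <= L / r * `|p - p'|.
Proof.
move=> ch hK L0 hL.
have mt := measurable_before tau.
have c1 : continuous (fun _ : R => 1 : R) by move=> x; exact: cvg_cst.
have b1 : forall x : R, `|(1 : R)| <= 1 by move=> _; rewrite normr1.
rewrite /disc -RintegralB//; try exact: integrable_disc hK.
have ib : mu.-integrable (before tau) (EFin \o (fun x => expR (- r * x) * h (bpath p x) -
   expR (- r * x) * h (bpath p' x))).
  by apply: integrable_EFinB => //; exact: integrable_disc hK.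
apply: (le_trans (le_normr_Rintegral mt ib)).
apply: (@le_trans _ _ ((L * `|p - p'|) * disc (fun=> 1) p tau)).
  rewrite -RintegralZl//; last exact: integrable_disc b1.
  apply: le_Rintegral => //.
  - exact: integrable_norm ib.
  - by apply: integrable_EFinZl => //; exact: integrable_disc b1.
  - move=> t [t0 _]; rewrite -mulrBr normrM ger0_norm ?expR_ge0// mulr1 mulrC.
    rewrite ler_wpM2r ?expR_ge0// (le_trans (hL _ _))//.
    by rewrite ler_wpM2l// bpath_dist.
have /andP[_ d1] := disc_one_le p tau.
by rewrite mulrAC ler_wpM2r// ler_wpM2l.
Qed.

Lemma disc_affine (h : R -> R) (K : R) a p p' tau : continuous h -> (forall x, `|h x| <= K) ->
  a \in `[0, 1] -> p \in `[0, 1] -> p' \in `[0, 1] ->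
  (forall a x y, a \in `[0, 1] -> x \in `[0, 1] -> y \in `[0, 1] ->
     h (a * x + (1 - a) * y) = a * h x + (1 - a) * h y) ->
  disc h (a * p + (1 - a) * p') tau = a * disc h p tau + (1 - a) * disc h p' tau.
Proof.
move=> ch hK aI pI pI' haff.
have mt := measurable_before tau.
have i1 := integrable_disc p tau ch hK; have i2 := integrable_disc p' tau ch hK.
rewrite /disc -(RintegralZl _ mt i1) -(RintegralZl _ mt i2) -RintegralD//; last 2 first.
- exact: integrable_EFinZl.
- exact: integrable_EFinZl.
apply: eq_Rintegral => t; rewrite inE => -[t0 _].
rewrite bpath_affine haff ?bpath_itv//; ring.
Qed.

End discounted_flow.

(** * Distributions of posteriors *)

Section mixture.
Context d (T : measurableType d) (R : realType).
Variables (a : R) (m1 m2 : probability T R).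
Hypothesis aI : 0 <= a <= 1.

Let a1_ge0 : 0 <= 1 - a. Proof. by case/andP: aI; rewrite subr_ge0. Qed.
Let a_ge0 : 0 <= a. Proof. by case/andP: aI. Qed.

Definition mixture_measure : set T -> \bar R :=
  measure_add (mscale (NngNum a1_ge0) m1) (mscale (NngNum a_ge0) m2).

HB.instance Definition _ := Measure.on mixture_measure.

Lemma mixture_measureE A : mixture_measure A = ((1 - a)%:E * m1 A + a%:E * m2 A)%E.
Proof. by rewrite /mixture_measure measure_addE. Qed.

Let mixture_measureT : mixture_measure setT = 1%E.
Proof.
by rewrite mixture_measureE !probability_setT !mule1 -EFinD subrK.
Qed.

HB.instance Definition _ :=
  Measure_isProbability.Build _ _ _ mixture_measure mixture_measureT.

Definition mixture : probability T R := mixture_measure.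

Lemma mixtureE A : mixture A = ((1 - a)%:E * m1 A + a%:E * m2 A)%E.
Proof. exact: mixture_measureE. Qed.

Lemma ge0_integral_mixture D (f : T -> \bar R) : measurable D ->
  (forall x, D x -> (0 <= f x)%E) -> measurable_fun D f ->
  (\int[mixture]_(x in D) f x =
   (1 - a)%:E * \int[m1]_(x in D) f x + a%:E * \int[m2]_(x in D) f x)%E.
Proof.
move=> mD f0 mf.
rewrite [LHS](@ge0_integral_measure_add _ _ _ (mscale (NngNum a1_ge0) m1)
  (mscale (NngNum a_ge0) m2))//.
by rewrite !ge0_integral_mscale.
Qed.

Lemma integral_mixture D (f : T -> \bar R) : measurable D ->
  m1.-integrable D f -> m2.-integrable D f ->
  (\int[mixture]_(x in D) f x =
   (1 - a)%:E * \int[m1]_(x in D) f x + a%:E * \int[m2]_(x in D) f x)%E.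
Proof.
move=> mD i1 i2.
have mf : measurable_fun D f by exact: measurable_int i1.
rewrite integralE ge0_integral_mixture//; last exact: measurable_funepos.
rewrite ge0_integral_mixture//; last exact: measurable_funeneg.
rewrite [X in _ = (_ * X + _)%E]integralE [X in _ = (_ + _ * X)%E]integralE.
have p1 := integrable_pos_fin_num mD i1; have n1 := integrable_neg_fin_num mD i1.
have p2 := integrable_pos_fin_num mD i2; have n2 := integrable_neg_fin_num mD i2.
rewrite -(fineK p1) -(fineK p2) -(fineK n1) -(fineK n2).
by rewrite -!(EFinM, EFinD, EFinB); congr EFin; ring.
Qed.

End mixture.

Section supporting_line.
Context {R : realType}.

(* If every chord of [f] passes below [s] at [q], then the slopes on the two
   sides of [q] are separated, and any separating number is a slope. *)
Lemma supporting_line (f : R -> R) (D : set R) (q s : R) :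
  (exists2 x, D x & x < q) -> (exists2 y, D y & q < y) ->
  (D q -> f q <= s) ->
  (forall x y, D x -> D y -> x < q -> q < y ->
     (y - q) * f x + (q - x) * f y <= s * (y - x)) ->
  exists m, forall x, D x -> f x <= s + m * (x - q).
Proof.
move=> [x0 Dx0 x0q] [y0 Dy0 qy0] fq chord.
pose S := [set (f y - s) / (y - q) | y in [set y | D y /\ q < y]].
have ubS x : D x -> x < q -> ubound S ((s - f x) / (q - x)).
  move=> Dx xq _ [y [Dy qy] <-].
  rewrite ler_pdivrMr ?subr_gt0// mulrAC ler_pdivlMr ?subr_gt0//.
  by have := chord x y Dx Dy xq qy; lra.
have supS : has_sup S.
  split; first by exists ((f y0 - s) / (y0 - q)), y0.
  by exists ((s - f x0) / (q - x0)); exact: ubS.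
exists (sup S) => x Dx; have [xq|qx|xq] := ltgtP x q; last first.
- by rewrite xq subrr mulr0 addr0 fq// -xq.
- have : (f x - s) / (x - q) <= sup S by apply: sup_upper_bound => //; exists x.
  by rewrite ler_pdivrMr ?subr_gt0//; lra.
- have : sup S <= (s - f x) / (q - x) by apply: ge_sup; [case: supS|exact: ubS].
  by rewrite ler_pdivlMr ?subr_gt0//; lra.
Qed.

End supporting_line.

Section integral_helpers.
Context d (T : measurableType d) (R : realType).
Implicit Types (D : set T).

(** Only the smaller function is integrable: the larger one will be the information cost, whose
    integral may be [+oo]. *)
Lemma le_integral_integrable_left (m : {measure set T -> \bar R}) D (f g : T -> \bar R) :
  measurable D -> m.-integrable D f -> measurable_fun D g ->
  (forall x, D x -> (f x <= g x)%E) ->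
  (\int[m]_(x in D) f x <= \int[m]_(x in D) g x)%E.
Proof.
move=> mD fi mg fg; have mf := measurable_int m fi.
rewrite integralE [leRHS]integralE; apply: leeB.
- apply: ge0_le_integral => //; [exact: measurable_funepos|exact: measurable_funepos|].
  by move=> x Dx; rewrite !funeposE ge_max le_max fg//= le_max lexx orbT.
- apply: ge0_le_integral => //; [exact: measurable_funeneg|exact: measurable_funeneg|].
  by move=> x Dx; rewrite !funenegE ge_max le_max leeN2 fg//= le_max lexx orbT.
Qed.

Lemma bounded_integrable (F : probability T R) D (w : T -> R) (M : R) : measurable D ->
  measurable_fun D w -> (forall x, D x -> `|w x| <= M) ->
  F.-integrable D (EFin \o w).
Proof.
move=> mD mw wM; apply: measurable_bounded_integrable => //.
  by rewrite (le_lt_trans (probability_le1 F mD))// ltry.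
exists M; split; first exact: num_real.
by move=> x Mx y Dy /=; rewrite (le_trans (wM _ Dy))// ltW.
Qed.

End integral_helpers.

Section unit_interval_distributions.
Context {R : realType}.
Local Notation I01 := (`[0%R, 1%R]%classic : set R).
Implicit Types (F : probability R R) (q : R).

Lemma inB_affine q F (a b : R) : inB q F ->
  (\int[F]_(x in I01) (a + b * x)%:E = (a + b * q)%:E)%E.
Proof.
move=> [F1 Fq].
have iid : F.-integrable I01 (EFin \o (fun x => x)).
  apply: (@bounded_integrable _ _ _ _ _ _ 1) => //.
  by move=> x /=; rewrite in_itv/= => /andP[x0 x1]; rewrite ger0_norm.
under eq_integral do rewrite EFinD EFinM.
rewrite integralD//; last 2 first.
- by apply: (@bounded_integrable _ _ _ _ _ (cst a) `|a|).
- exact: integrableZl.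
rewrite integralZl// Fq [X in (X + _)%E](integral_cst F (measurable_itv _)).
rewrite [X in (_ * X)%E]F1 mule1.
by rewrite -EFinM -EFinD.
Qed.

(** At an endpoint [|x - q|] is affine on the unit interval, so its mean is 0 and [F] is
    concentrated at [q]. *)
Lemma inB_endpoint q F (f : R -> \bar R) : q = 0 \/ q = 1 -> inB q F ->
  measurable_fun I01 f -> (\int[F]_(x in I01) f x = f q)%E.
Proof.
move=> q01 FB mf.
have h0 : ae_eq F I01 (fun x => (x - q)%:E) (cst 0%E).
  apply/ae_eq_integral_abs => //.
    by apply/measurable_EFinP; apply: measurable_funB => //; exact: measurable_id.
  case: q01 => q01.
    rewrite (eq_integral (fun x : R => (0 + 1 * x)%:E)).
      by rewrite (inB_affine _ _ FB) q01 mulr0 addr0.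
    move=> x; rewrite inE/= in_itv/= => /andP[x0 x1].
    by rewrite q01 subr0 add0r mul1r ger0_norm.
  rewrite (eq_integral (fun x : R => (1 + - 1 * x)%:E)).
    by rewrite (inB_affine _ _ FB) q01; congr EFin; ring.
  move=> x; rewrite inE/= in_itv/= => /andP[x0 x1].
  by rewrite q01 distrC ger0_norm ?subr_ge0// mulN1r.
have : ae_eq F I01 f (cst (f q)).
  by apply: filterS h0 => x /= H /H [] /eqP; rewrite subr_eq0 => /eqP ->.
move=> /(ae_eq_integral _ _ _ mf) -> //.
by case: FB => F1 _; rewrite integral_cst// [X in (_ * X)%E]F1 mule1.
Qed.

Lemma lottery_weight_itv x q y : x < q < y -> 0 <= (q - x) / (y - x) <= 1.
Proof.
move=> /andP[xq qy]; have yx : 0 < y - x by lra.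
by rewrite ler_pdivlMr// ler_pdivrMr//; apply/andP; split; lra.
Qed.

Definition lottery x y q (h : x < q < y) : probability R R :=
  mixture \d_x \d_y (lottery_weight_itv h).

Lemma lotteryE x y q (h : x < q < y) B : lottery h B =
  ((1 - (q - x) / (y - x))%:E * \d_x B + ((q - x) / (y - x))%:E * \d_y B)%E.
Proof. exact: mixtureE. Qed.

Lemma integral_lottery x y q (h : x < q < y) (f : R -> \bar R) :
  x \in `[0, 1] -> y \in `[0, 1] -> measurable_fun I01 f ->
  f x \is a fin_num -> f y \is a fin_num ->
  (\int[lottery h]_(z in I01) f z =
   (((y - q) * fine (f x) + (q - x) * fine (f y)) / (y - x))%:E)%E.
Proof.
move=> xI yI mf fx fy; have /andP[xq qy] := h; have yx : 0 < y - x by lra.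
have idx (a : R) : f a \is a fin_num -> (\d_ a : probability R R).-integrable I01 f.
  move=> fa; apply/integrableP; split => //.
  rewrite integral_dirac//; last exact: measurableT_comp.
  rewrite diracE; case: (_ \in _); rewrite ?mul1e ?mul0e ?ltry//.
  by rewrite -(fineK fa) ltry.
rewrite integral_mixture//; try exact: idx.
rewrite !integral_dirac// !diracE !mem_set//= !mul1e.
rewrite -[in LHS](fineK fx) -[in LHS](fineK fy) -!EFinM -EFinD; congr EFin.
by field; rewrite gt_eqF.
Qed.

Lemma lottery_itv x y q (h : x < q < y) : x \in `[0, 1] -> y \in `[0, 1] ->
  lottery h I01 = 1%E.
Proof.
move=> xI yI; rewrite lotteryE !diracE !mem_set//= !mule1 -EFinD.
by congr EFin; ring.
Qed.

Lemma inB_lottery x y q (h : x < q < y) : x \in `[0, 1] -> y \in `[0, 1] ->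
  inB q (lottery h).
Proof.
move=> xI yI; have /andP[xq qy] := h; have yx : 0 < y - x by lra.
split; first exact: lottery_itv.
rewrite integral_lottery//=; congr EFin.
by field; rewrite gt_eqF.
Qed.

Lemma inB_dirac q : q \in `[0, 1] -> inB q (\d_ q : probability R R).
Proof.
move=> qI; split; first by rewrite /= diracE mem_set.
rewrite integral_dirac//.
by rewrite diracE mem_set// mul1e.
Qed.

End unit_interval_distributions.

(** * Disintegration of a posterior along a history *)

(** The integral of a nonnegative function is a supremum over the simple functions below it, so
    monotonicity needs no measurability. This serves to compare with the total cost of a policy,
    which need not be measurable. *)
Lemma ge0_le_integral_any d (T : measurableType d) (R : realType)
    (m : {measure set T -> \bar R}) (f g : T -> \bar R) :
  (forall x, (0 <= f x)%E) -> (forall x, (f x <= g x)%E) ->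
  (\int[m]_x f x <= \int[m]_x g x)%E.
Proof.
move=> f0 fg; have g0 x : (0 <= g x)%E by exact: le_trans (f0 x) (fg x).
rewrite !ge0_integralTE//; apply: ereal_sup_le => z [h hf <-]; exists h => // x.
exact: le_trans (hf x) (fg x).
Qed.

Section ge0_measurable_ind.
Context d (T : measurableType d) (R : realType).
Variable Phi : (T -> \bar R) -> Prop.

Definition ge0_measurable (f : T -> \bar R) :=
  measurable_fun setT f /\ forall x, (0 <= f x)%E.

Hypothesis Phi_indic : forall B, measurable B -> Phi (fun x => (\1_B x)%:E).
Hypothesis Phi_scale : forall (k : R) f, 0 <= k -> ge0_measurable f -> Phi f ->
  Phi (fun x => (k%:E * f x)%E).
Hypothesis Phi_add : forall f g, ge0_measurable f -> ge0_measurable g ->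
  Phi f -> Phi g -> Phi (fun x => (f x + g x)%E).
Hypothesis Phi_lim : forall f : nat -> T -> \bar R, (forall n, ge0_measurable (f n)) ->
  (forall x, nondecreasing_seq (f ^~ x)) -> (forall n, Phi (f n)) ->
  Phi (fun x => limn (f ^~ x)).

Import HBNNSimple.

Let Phi_nnsfun (f : {nnsfun T >-> R}) : Phi (fun x => (f x)%:E).
Proof.
have -> : (fun x => (f x)%:E) = (fun x => \sum_(k <- fset_set (range f))
    (k%:E * (\1_(f @^-1` [set k]) x)%:E)%E)%E.
  apply/funext => x; rewrite fimfunE fsbig_finite//= -sumEFin.
  by apply: eq_bigr => k _; rewrite EFinM.
have : forall k, k \in enum_fset (fset_set (range f)) -> 0 <= k.
  move=> k; rewrite -[_ \in _]/(k \in fset_set (range f)).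
  by rewrite in_fset_set// => /set_mem[x _ <-].
elim: (enum_fset _) => [_|k s IH hs].
  under eq_fun do rewrite big_nil.
  by have := Phi_indic measurable0; under eq_fun do rewrite indic0.
under eq_fun do rewrite big_cons.
have k0 : 0 <= k by apply: hs; rewrite in_cons eqxx.
have gm (l : R) : ge0_measurable (fun x : T => (\1_(f @^-1` [set l]) x)%:E).
  by split => [|x]; [apply/measurable_EFinP; exact: measurable_indic|rewrite lee_fin].
have hs' l : l \in s -> 0 <= l by move=> ls; apply: hs; rewrite in_cons ls orbT.
apply: Phi_add.
- split => [|x]; last by rewrite mule_ge0// lee_fin.
  by apply: measurable_funeM; exact: (gm k).1.
- split => [|x].
    by apply: emeasurable_sum => l; apply: measurable_funeM; exact: (gm l).1.
  rewrite big_seq; apply: sume_ge0 => l ls; rewrite mule_ge0// lee_fin//.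
  exact: hs'.
- by apply: Phi_scale => //; apply: Phi_indic.
- exact: IH.
Qed.

(** A simple function is the sum of its values times the indicators of its level sets, and [f] is an
    increasing limit of simple functions. *)
Lemma ge0_measurable_ind f : ge0_measurable f -> Phi f.
Proof.
move=> [mf f0]; pose f_ := nnsfun_approx measurableT mf.
have -> : f = (fun x => limn (fun n => (f_ n x)%:E)).
  apply/funext => x; apply/esym/cvg_lim => //; exact: cvg_nnsfun_approx.
apply: (@Phi_lim (fun n x => (f_ n x)%:E)).
- by move=> n; split => [|x]; [exact/measurable_EFinP|rewrite lee_fin].
- by move=> x m n mn; rewrite lee_fin; exact/lefP/nd_nnsfun_approx.
- by move=> n; exact: Phi_nnsfun.
Qed.

End ge0_measurable_ind.

Section eq_integral_class.
Context d (Om : measurableType d) (R : realType) (mu : {measure set Om -> \bar R}).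
Context d' (T : measurableType d').

(* Two integral representations of the same positive functional agree on all
   nonnegative measurable functions as soon as they agree on indicators. *)
Lemma eq_integral_functional (D : set Om) (J1 J2 : (T -> \bar R) -> Om -> \bar R) :
  measurable D ->
  (forall i : bool, let J := if i then J1 else J2 in
    [/\ forall f, ge0_measurable f ->
          measurable_fun D (J f) /\ forall w, D w -> (0 <= J f w)%E,
        forall (k : R) f w, D w -> 0 <= k -> ge0_measurable f ->
          J (fun x => (k%:E * f x)%E) w = (k%:E * J f w)%E,
        forall f g w, D w -> ge0_measurable f -> ge0_measurable g ->
          J (fun x => (f x + g x)%E) w = (J f w + J g w)%E &
        forall (f : nat -> T -> \bar R) w, D w -> (forall n, ge0_measurable (f n)) ->
          (forall x, nondecreasing_seq (f ^~ x)) ->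
          nondecreasing_seq (fun n => J (f n) w) /\
          J (fun x => limn (f ^~ x)) w = limn (fun n => J (f n) w)]) ->
  (forall B, measurable B -> (\int[mu]_(w in D) J1 (fun x => (\1_B x)%:E) w =
     \int[mu]_(w in D) J2 (fun x => (\1_B x)%:E) w)%E) ->
  forall f, ge0_measurable f ->
    (\int[mu]_(w in D) J1 f w = \int[mu]_(w in D) J2 f w)%E.
Proof.
move=> mD HJ HI f gf.
have [m1 s1 a1 l1] := HJ true; have [m2 s2 a2 l2] := HJ false.
rewrite /= in m1 s1 a1 l1 m2 s2 a2 l2.
apply: (@ge0_measurable_ind _ T R
  (fun f => (\int[mu]_(w in D) J1 f w = \int[mu]_(w in D) J2 f w)%E)) => //.
- move=> k h k0 gh IH.
  rewrite (eq_integral (fun w => k%:E * J1 h w)%E); last first.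
    by move=> w /set_mem Dw; exact: s1.
  rewrite [RHS](eq_integral (fun w => k%:E * J2 h w)%E); last first.
    by move=> w /set_mem Dw; exact: s2.
  have [mj1 p1] := m1 h gh; have [mj2 p2] := m2 h gh.
  by rewrite !ge0_integralZl_EFin// IH.
- move=> g h gg gh Ig Ih.
  rewrite (eq_integral (fun w => J1 g w + J1 h w)%E); last first.
    by move=> w /set_mem Dw; exact: a1.
  rewrite [RHS](eq_integral (fun w => J2 g w + J2 h w)%E); last first.
    by move=> w /set_mem Dw; exact: a2.
  have [mg1 pg1] := m1 g gg; have [mg2 pg2] := m2 g gg.
  have [mh1 ph1] := m1 h gh; have [mh2 ph2] := m2 h gh.
  by rewrite !ge0_integralD// Ig Ih.
- move=> g gg ndg Ig.
  rewrite (eq_integral (fun w => limn (fun n => J1 (g n) w))); last first.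
    by move=> w /set_mem Dw; exact: (l1 g w Dw gg ndg).2.
  rewrite [RHS](eq_integral (fun w => limn (fun n => J2 (g n) w))); last first.
    by move=> w /set_mem Dw; exact: (l2 g w Dw gg ndg).2.
  rewrite monotone_convergence//; last 3 first.
  + by move=> n; exact: (m1 _ (gg n)).1.
  + by move=> n w Dw; exact: (m1 _ (gg n)).2.
  + by move=> w Dw; exact: (l1 g w Dw gg ndg).1.
  rewrite monotone_convergence//; last 3 first.
  + by move=> n; exact: (m2 _ (gg n)).1.
  + by move=> n w Dw; exact: (m2 _ (gg n)).2.
  + by move=> w Dw; exact: (l2 g w Dw gg ndg).1.
  by congr (limn _); apply/funext => n; exact: Ig.
Qed.

End eq_integral_class.

Section disintegration.
Context d (Om : measurableType d) (R : realType) (P : probability Om R).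
Variables (gen : set (set Om)) (A : set Om) (Q : Om -> R) (F : Om -> probability R R).
Hypothesis gen_measurable : <<s gen >> `<=` measurable.
Hypothesis mA : measurable A.
Hypothesis mQ : measurable_fun setT Q.
Hypothesis mF : forall B : set R, measurable B -> measurable_fun setT (fun w => F w B).
Hypothesis PF : forall (E : set Om) (B : set R), <<s gen >> E -> measurable B ->
  P (E `&` A `&` Q @^-1` B) = (\int[P]_(w in E `&` A) F w B)%E.

Let measurable_average (g : R -> \bar R) : ge0_measurable g ->
  measurable_fun setT (fun w => \int[F w]_x g x)%E.
Proof.
move=> [mg g0].
exact: (@measurable_fun_integral_kernel _ _ _ _ _ (fun w => F w)).
Qed.

Let integral_average_event (E : set Om) (g : R -> \bar R) : <<s gen >> E ->
  ge0_measurable g ->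
  (\int[P]_(w in E `&` A) g (Q w) = \int[P]_(w in E `&` A) \int[F w]_x g x)%E.
Proof.
move=> gE gg.
have mE : measurable (E `&` A) by apply: measurableI => //; exact: gen_measurable.
apply: (@eq_integral_functional _ Om R P _ R (E `&` A) (fun g w => g (Q w))
  (fun g w => \int[F w]_x g x)%E) => //.
- case=> /=; split.
  + move=> f [mf f0]; split => // ; apply: measurable_funTS.
    exact: measurableT_comp.
  + by [].
  + by [].
  + by move=> f w _ gf nd; split => //; exact: nd.
  + move=> f gf; split => [|w _]; first exact/measurable_funTS/measurable_average.
    by apply: integral_ge0 => x _; exact: gf.2.
  + by move=> k f w _ k0 [mf f0]; rewrite ge0_integralZl_EFin.
  + by move=> f h w _ [mf f0] [mh h0]; rewrite ge0_integralD.
  + move=> f w _ gf nd; split.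
      move=> m n mn; apply: ge0_le_integral => //.
      * by move=> x _; exact: (gf m).2.
      * exact: (gf m).1.
      * exact: (gf n).1.
      * by move=> x _; exact: nd.
    rewrite monotone_convergence//.
    * by move=> n; exact: (gf n).1.
    * by move=> n x _; exact: (gf n).2.
- move=> B mB; under eq_integral.
    move=> w _; rewrite (_ : \1_B (Q w) = \1_(Q @^-1` B) w); first over.
    by rewrite !indicE; congr (_%:R); apply/idP/idP; rewrite !inE.
  rewrite integral_indic//; last by rewrite -[X in measurable X]setTI; exact: mQ.
  rewrite setIC; etransitivity; first exact: (PF gE mB).
  by apply: eq_integral => w _; rewrite integral_indic// setIT.
Qed.

(** Two monotone class arguments: [integral_average_event] has replaced the indicator of a set of
    posteriors by [g]; here the indicator of a history event is replaced by a history-measurable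
    weight [Y]. Boundedness of [g] keeps the second factor finite, so that products commute with
    increasing limits. *)
Lemma integral_average (Y : Om -> \bar R) (g : R -> \bar R) :
  (forall U, measurable U -> <<s gen >> (Y @^-1` U)) -> (forall w, (0 <= Y w)%E) ->
  ge0_measurable g -> (exists M : R, forall x, (g x <= M%:E)%E) ->
  (\int[P]_(w in A) (Y w * g (Q w)) = \int[P]_(w in A) (Y w * \int[F w]_x g x))%E.
Proof.
move=> mY Y0 gg [M gM]; have [mg g0] := gg.
(* [T'] is the sample space equipped with the history sigma-algebra, so the induction runs over
   history-measurable weights only. *)
pose T' := g_sigma_algebraType gen.
have mT' (f : T' -> \bar R) : ge0_measurable f -> measurable_fun A (f : Om -> \bar R).
  move=> [mf _] _ U mU; apply: measurableI => //; apply: gen_measurable.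
  by have := mf measurableT U mU; rewrite setTI.
have mgQ : measurable_fun A (fun w => g (Q w)).
  by apply: measurable_funTS; exact: measurableT_comp.
have mav : measurable_fun A (fun w => \int[F w]_x g x)%E.
  exact/measurable_funTS/measurable_average.
have av0 w : (0 <= \int[F w]_x g x)%E by apply: integral_ge0 => x _; exact: g0.
have avM w : ((\int[F w]_x g x)%E \is a fin_num).
  rewrite ge0_fin_numE//; apply: (@le_lt_trans _ _ (\int[F w]_x (cst M%:E) x)%E).
    by apply: ge0_le_integral => // x _; rewrite (le_trans (g0 0) (gM 0)).
  by rewrite integral_cst// [X in (_ * X)%E]probability_setT mule1 ltry.
have gfin x : g x \is a fin_num by rewrite ge0_fin_numE// (le_lt_trans (gM x))// ltry.
have Jprop (h : Om -> \bar R) : measurable_fun A h -> (forall w, (0 <= h w)%E) ->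
    (forall w, h w \is a fin_num) ->
  let J := fun (f : T' -> \bar R) (w : Om) => (f w * h w)%E in
    [/\ forall f, ge0_measurable f ->
          measurable_fun A (J f) /\ forall w, A w -> (0 <= J f w)%E,
        forall (k : R) f w, A w -> 0 <= k -> ge0_measurable f ->
          J (fun x => (k%:E * f x)%E) w = (k%:E * J f w)%E,
        forall f g w, A w -> ge0_measurable f -> ge0_measurable g ->
          J (fun x => (f x + g x)%E) w = (J f w + J g w)%E &
        forall (f : nat -> T' -> \bar R) w, A w -> (forall n, ge0_measurable (f n)) ->
          (forall x, nondecreasing_seq (f ^~ x)) ->
          nondecreasing_seq (fun n => J (f n) w) /\
          J (fun x => limn (f ^~ x)) w = limn (fun n => J (f n) w)].
  move=> mh h0 hfin J; split.
  - move=> f gf; split => [|w _]; last by rewrite mule_ge0// gf.2.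
    by apply: emeasurable_funM => //; exact: mT'.
  - by move=> k f w _ _ _; rewrite /J muleA.
  - by move=> f f' w _ gf gf'; rewrite /J ge0_muleDl// ?gf.2 ?gf'.2.
  - move=> f w _ gf nd; split.
      by move=> m n mn; rewrite /J lee_wpmul2r// nd.
    rewrite /J; apply/esym/cvg_lim => //; apply: cvgeZr => //.
    exact: ereal_nondecreasing_is_cvgn.
apply: (@eq_integral_functional _ Om R P _ T' A (fun f w => f w * g (Q w))%E
  (fun f w => f w * \int[F w]_x g x)%E) => //.
- by case; apply: Jprop.
- move=> B mB.
  have mB' : measurable (B : set Om) by exact: gen_measurable.
  have indE (h : Om -> \bar R) : (\int[P]_(w in A) ((\1_B w)%:E * h w) =
      \int[P]_(w in B `&` A) h w)%E.
    rewrite setIC integral_mkcondr; apply: eq_integral => w _.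
    by rewrite /patch indicE; case: (w \in B); rewrite ?mul1e ?mul0e.
  by rewrite !indE integral_average_event.
- split => // _ U mU; rewrite setTI; exact: mY.
Qed.

End disintegration.

(** * The least superharmonic function *)

Section clamp.
Context {R : realType}.
Implicit Types x y : R.

Definition clamp x : R := Num.max 0 (Num.min x 1).

Lemma clamp_itv x : clamp x \in `[0, 1].
Proof.
by rewrite in_itv/= /clamp le_max lexx/= ge_max ler01 ge_min lexx orbT.
Qed.

Lemma clamp_id x : x \in `[0, 1] -> clamp x = x.
Proof.
by rewrite in_itv/= /clamp => /andP[x0 x1]; rewrite min_l// max_r.
Qed.

Lemma clamp_dist x y : `|clamp x - clamp y| <= `|x - y|.
Proof.
rewrite /clamp; wlog xy : x y / x <= y => [H|].
  by have [/H//|/ltW/H] := leP x y; rewrite distrC (distrC y).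
rewrite distrC (distrC x) ger0_norm; last first.
  by rewrite subr_ge0 /Num.max /Num.min; repeat (case: ifPn); lra.
rewrite ger0_norm ?subr_ge0// /Num.max /Num.min.
repeat (case: ifPn); rewrite -?leNgt; lra.
Qed.

Lemma itvoo_itvcc x : x \in `]0, 1[ -> x \in `[0, 1].
Proof. exact: subset_itv_oo_cc. Qed.

Lemma itvcc_cases x : x \in `[0, 1] -> [\/ x = 0, x = 1 | x \in `]0, 1[].
Proof.
rewrite !in_itv/= => /andP[]; rewrite !le_eqVlt.
move=> /predU1P[->|x0]; first by constructor 1.
move=> /predU1P[->|x1]; first by constructor 2.
by constructor 3; rewrite x0.
Qed.

Lemma weight_itv x q y : x < q < y -> (y - q) / (y - x) \in `[0, 1].
Proof.
move=> /andP[xq qy]; have yx : 0 < y - x by lra.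
by rewrite in_itv/= ler_pdivlMr// ler_pdivrMr//; apply/andP; split; lra.
Qed.

Lemma dist_continuous (h : R -> R) (L : R) :
  (forall x y, `|h x - h y| <= L * `|x - y|) -> continuous h.
Proof.
move=> hL x.
have M0 : 0 < `|L| + 1 by rewrite ltr_wpDl.
apply/cvgrPdist_lt => e e0; near=> y.
apply: (le_lt_trans (hL x y)).
apply: (@le_lt_trans _ _ ((`|L| + 1) * `|x - y|)).
  by rewrite ler_wpM2r// (le_trans (ler_norm L))// lerDl.
rewrite -ltr_pdivlMl// mulrC; near: y.
by apply/nbhs_ballP; exists (e / (`|L| + 1)) => //=; exact: divr_gt0.
Unshelve. all: by end_near. Qed.

End clamp.

Section model_payoffs.
Context {R : realType}.
Variables (lam0 lam1 r : R) (A : Type) (ut : A -> bool -> R).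
Hypotheses (lam0_gt0 : 0 < lam0) (lam1_gt0 : 0 < lam1) (r_gt0 : 0 < r).
Hypothesis u_max : forall p : R, p \in `[0, 1] ->
  exists a, forall b, expected_ut ut p b <= expected_ut ut p a.
Local Notation u := (u ut).
Local Notation bpath := (bpath lam0 lam1).
Local Notation disc := (disc lam0 lam1 r).

(** * Regularity of the indirect utility and the two benchmark values *)

Lemma u_attained p : p \in `[0, 1] -> exists2 a, u p = expected_ut ut p a &
  forall b, expected_ut ut p b <= expected_ut ut p a.
Proof.
move=> pI; have [a ha] := u_max pI; exists a => //.
apply/eqP; rewrite eq_le /u; apply/andP; split.
  by apply: ge_sup; [exists (expected_ut ut p a), a|move=> _ [b _ <-]; exact: ha].
apply: ub_le_sup; last by exists a.
by exists (expected_ut ut p a) => _ [b _ <-]; exact: ha.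
Qed.

Lemma expected_ut_le_u p a : p \in `[0, 1] -> expected_ut ut p a <= u p.
Proof. by move=> /u_attained[b -> ->]. Qed.

(* The actions optimal at the two endpoints bound the slopes of all optimal
   actions, since optimal slopes increase with the belief. *)
Lemma u_lipschitz : exists2 L, 0 <= L & forall p q, p \in `[0, 1] -> q \in `[0, 1] ->
  `|u p - u q| <= L * `|p - q|.
Proof.
have I0 : (0 : R) \in `[0, 1] by rewrite in_itv/= lexx ler01.
have I1 : (1 : R) \in `[0, 1] by rewrite in_itv/= lexx ler01.
have [a0 _ h0] := u_attained I0; have [a1 _ h1] := u_attained I1.
pose sl a := ut a true - ut a false.
exists (`|sl a0| + `|sl a1|); first by rewrite addr_ge0.
have key p q : p \in `[0, 1] -> q \in `[0, 1] -> p < q ->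
    sl a0 * (q - p) <= u q - u p <= sl a1 * (q - p).
  move=> pI qI pq.
  move: (pI) (qI); rewrite !in_itv/= => /andP[p0 p1] /andP[q0 q1].
  have [a pa ha] := u_attained pI; have [b qb hb] := u_attained qI.
  have := expected_ut_le_u a qI; have := expected_ut_le_u b pI.
  have := ha a0; have := hb a1; have := h0 a; have := h1 b.
  have := expected_ut_le_u a0 qI; have := expected_ut_le_u a1 pI.
  rewrite pa qb /expected_ut /sl !(subr0, subrr, mul0r, mul1r, add0r, addr0).
  move=> e1 e2 e3 e4 e5 e6 e7 e8; apply/andP; split.
    (* For [p > 0], optimality of [a0] at 0 and of [a] at [p] give [sl a0 <= sl a]. At [p = 0] ties
       may break this, but then [a0] can be tested at [q] directly. The upper bound treats [q = 1]
       in the same way. *)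
    move: p0; rewrite le_eqVlt => /predU1P[p0|p0].
      by move: e2 e4 e6; rewrite -p0; lra.
    have sa : sl a0 <= sl a by rewrite /sl -(ler_pM2l p0); lra.
    have : sl a0 * (q - p) <= sl a * (q - p) by rewrite ler_wpM2r// subr_ge0 ltW.
    by move: e8; rewrite /sl; lra.
  move: q1; rewrite le_eqVlt => /predU1P[q1|q1].
    by move: e1 e3 e5; rewrite q1; lra.
  have q1' : 0 < 1 - q by rewrite subr_gt0.
  have sb : sl b <= sl a1 by rewrite /sl -(ler_pM2l q1'); lra.
  have : sl b * (q - p) <= sl a1 * (q - p) by rewrite ler_wpM2r// subr_ge0 ltW.
  by move: e7; rewrite /sl; lra.
have key' p q : p \in `[0, 1] -> q \in `[0, 1] -> p < q ->
    `|u p - u q| <= (`|sl a0| + `|sl a1|) * `|p - q|.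
  move=> pI qI pq; have /andP[l1 l2] := key _ _ pI qI pq.
  rewrite distrC (distrC p) (ger0_norm (ltW _ : 0 <= q - p)) ?subr_gt0//.
  have qp : 0 <= q - p by rewrite subr_ge0 ltW.
  rewrite ler_norml; apply/andP; split.
    apply: le_trans l1; rewrite -mulNr ler_wpM2r//.
    by have := ler_norm (- sl a0); have := normr_ge0 (sl a1); rewrite normrN; lra.
  apply: (le_trans l2); rewrite ler_wpM2r//.
  by have := ler_norm (sl a1); have := normr_ge0 (sl a0); lra.
move=> p q pI qI; have [pq|qp|->] := ltgtP p q.
- exact: key'.
- by rewrite distrC (distrC p); exact: key'.
- by rewrite !subrr normr0 mulr0.
Qed.

Lemma umaxE b : umax ut b = u b%:R.
Proof.
rewrite /umax /u; congr sup; apply/seteqP; split => _ [a _ <-]; exists a => //;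
  rewrite /expected_ut; case: b => /=; ring.
Qed.

(* Clamping the belief makes the flow payoffs continuous and bounded on the
   whole line. *)
Definition uc x := u (clamp x).

Definition ubar x := (1 - clamp x) * umax ut false + clamp x * umax ut true.

Lemma u_le_ubar p : p \in `[0, 1] -> u p <= ubar p.
Proof.
move=> pI; have [a -> _] := u_attained pI; rewrite /ubar clamp_id// !umaxE.
move: (pI); rewrite in_itv/= => /andP[p0 p1].
have I0 : (0 : R) \in `[0, 1] by rewrite in_itv/= lexx ler01.
have I1 : (1 : R) \in `[0, 1] by rewrite in_itv/= lexx ler01.
have := expected_ut_le_u a I0; have := expected_ut_le_u a I1.
rewrite /expected_ut !(subr0, subrr, mul0r, mul1r, add0r, addr0) => h1 h0.
by rewrite lerD// ler_wpM2l// subr_ge0.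
Qed.

Lemma uc_dist : exists2 L, 0 <= L & forall x y, `|uc x - uc y| <= L * `|x - y|.
Proof.
have [L L0 hL] := u_lipschitz; exists L => // x y.
rewrite (le_trans (hL _ _ (clamp_itv x) (clamp_itv y)))// ler_wpM2l//.
exact: clamp_dist.
Qed.

Lemma uc_continuous : continuous uc.
Proof. by have [L _] := uc_dist; exact: dist_continuous. Qed.

Lemma ubar_continuous : continuous ubar.
Proof.
apply: (@dist_continuous _ _ `|umax ut true - umax ut false|) => x y.
rewrite /ubar [X in `|X|](_ : _ =
  (umax ut true - umax ut false) * (clamp x - clamp y)); last by ring.
by rewrite normrM ler_wpM2l// clamp_dist.
Qed.

Lemma uc_ubar_bound : exists2 K, 0 <= K &
  (forall x, `|uc x| <= K) /\ (forall x, `|ubar x| <= K).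
Proof.
have [L L0 hL] := u_lipschitz.
have I0 : (0 : R) \in `[0, 1] by rewrite in_itv/= lexx ler01.
have I1 : (1 : R) \in `[0, 1] by rewrite in_itv/= lexx ler01.
have uK q : q \in `[0, 1] -> `|u q| <= `|u 0| + L.
  move=> qI; rewrite -[u q](subrK (u 0)) addrC (le_trans (ler_normD _ _))// lerD2l.
  apply: (le_trans (hL _ _ qI I0)); rewrite subr0 ler_piMr//.
  by move: qI; rewrite in_itv/= => /andP[q0 q1]; rewrite ger0_norm.
exists (`|u 0| + L); first by rewrite addr_ge0.
split => x; first exact/uK/clamp_itv.
rewrite /ubar !umaxE /=; have := clamp_itv x; rewrite in_itv/=.
move: (clamp x) (uK _ I0) (uK _ I1) => y h0 h1 /andP[y0 y1].
apply: (le_trans (ler_normD _ _)); rewrite !normrM.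
rewrite (ger0_norm y0) (ger0_norm (_ : 0 <= 1 - y)) ?subr_ge0//.
have -> : `|u 0| + L = (1 - y) * (`|u 0| + L) + y * (`|u 0| + L) by ring.
by rewrite lerD// ler_wpM2l// subr_ge0.
Qed.

(** [vl] and [vb] are the real-valued forms of [vlow] and [vbar] (see [vlowE] and [vbarE]). *)
Definition vl p := disc uc p +oo.
Definition vb p := disc ubar p +oo.

Lemma integral_u_before p tau : p \in `[0, 1] ->
  (\int[lebesgue_measure]_(t in before tau) (expR (- r * t) * u (bpath p t))%:E
   = (disc uc p tau)%:E)%E.
Proof.
move=> pI; have [K _ [hK _]] := uc_ubar_bound.
rewrite -(integral_disc _ _ r_gt0 _ _ uc_continuous hK).
apply: eq_integral => t; rewrite inE => -[t0 _].
by rewrite /uc clamp_id// bpath_itv.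
Qed.

Lemma integral_u_itv p s : p \in `[0, 1] ->
  (\int[lebesgue_measure]_(t in `[0%R, s]) (expR (- r * t) * u (bpath p t))%:E
   = (disc uc p s%:E)%:E)%E.
Proof.
move=> pI; rewrite -integral_u_before// before_fin integral_itv_bndo_bndc//.
apply/measurable_EFinP.
apply: (@eq_measurable_fun _ _ _ _ _ (fun t => expR (- r * t) * uc (bpath p t))).
  move=> t; rewrite inE/= in_itv/= => /andP[t0 _].
  by rewrite /uc clamp_id// bpath_itv.
apply: measurable_funTS; apply: continuous_measurable_fun.
exact: continuous_disc_integrand uc_continuous.
Qed.

Lemma vlowE p : p \in `[0, 1] -> vlow lam0 lam1 r ut p = (vl p)%:E.
Proof. by move=> pI; rewrite /vlow -before_pinfty integral_u_before. Qed.

Lemma vbarE p : p \in `[0, 1] -> vbar lam0 lam1 r ut p = (vb p)%:E.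
Proof.
move=> pI; have [K _ [_ hK]] := uc_ubar_bound.
rewrite /vbar -before_pinfty -(integral_disc _ _ r_gt0 _ _ ubar_continuous hK).
apply: eq_integral => t; rewrite inE => -[t0 _].
by rewrite /ubar clamp_id// bpath_itv.
Qed.

Lemma disc_uc_le_ubar p tau : p \in `[0, 1] -> disc uc p tau <= disc ubar p tau.
Proof.
move=> pI; have [K _ [hK hK']] := uc_ubar_bound.
apply: (le_disc _ _ _ _ uc_continuous ubar_continuous hK hK') => // q qI.
by rewrite /uc clamp_id// u_le_ubar.
Qed.

Lemma vl_split p s : 0 <= s -> vl p = disc uc p s%:E + expR (- r * s) * vl (bpath p s).
Proof.
move=> s0; have [K _ [hK _]] := uc_ubar_bound.
rewrite /vl -(discD _ _ _ _ uc_continuous hK)//.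
Qed.

Lemma disc_split p s s' : 0 <= s -> 0 <= s' ->
  disc uc p (s + s')%:E = disc uc p s%:E + expR (- r * s) * disc uc (bpath p s) s'%:E.
Proof.
move=> s0 s0'; have [K _ [hK _]] := uc_ubar_bound.
by rewrite EFinD (discD _ _ _ _ uc_continuous hK).
Qed.

Lemma vb_split_ge p s : 0 <= s -> p \in `[0, 1] ->
  disc uc p s%:E + expR (- r * s) * vb (bpath p s) <= vb p.
Proof.
move=> s0 pI; have [K _ [hK hK']] := uc_ubar_bound.
rewrite {2}/vb -[+oo%E](@addey _ s%:E)// (discD _ _ _ _ ubar_continuous hK')//.
by rewrite lerD2r disc_uc_le_ubar.
Qed.

(** The full-information flow is affine in the belief and the belief path is affine in its start.
    Hence a lottery leaves the expected [vb] unchanged, and acquiring information against [vb] only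
    loses the cost. *)
Lemma vb_affine a p q : a \in `[0, 1] -> p \in `[0, 1] -> q \in `[0, 1] ->
  vb (a * p + (1 - a) * q) = a * vb p + (1 - a) * vb q.
Proof.
move=> aI pI qI; have [K _ [hK hK']] := uc_ubar_bound.
rewrite /vb (disc_affine _ _ _ _ ubar_continuous hK')// => b x y bI xI yI.
rewrite /ubar !clamp_id//; first by ring.
move: bI xI yI; rewrite !in_itv/= => /andP[b0 b1] /andP[x0 x1] /andP[y0 y1].
by apply/andP; split; nra.
Qed.

Lemma vl_le_vb p : p \in `[0, 1] -> vl p <= vb p.
Proof. exact: disc_uc_le_ubar. Qed.

Lemma vb_chord x y q : x \in `[0, 1] -> y \in `[0, 1] -> x < q < y ->
  (y - q) * vb x + (q - x) * vb y = (y - x) * vb q.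
Proof.
move=> xI yI /andP[xq qy]; have yx : 0 < y - x by lra.
have -> : q = (y - q) / (y - x) * x + (1 - (y - q) / (y - x)) * y.
  by field; rewrite gt_eqF.
rewrite vb_affine//; last by apply: weight_itv; rewrite xq.
by field; rewrite gt_eqF.
Qed.

Variables (kappa : R) (c : R -> \bar R).
Hypothesis kappa_gt0 : 0 < kappa.
Hypothesis c_ge0 : forall x : R, x \in `[0, 1] -> (0 <= c x)%E.
Hypothesis c_convex : forall x y t : R,
  x \in `[0, 1] -> y \in `[0, 1] -> t \in `[0, 1] ->
  (c (t * x + (1 - t) * y)%R <= t%:E * c x + (1 - t)%R%:E * c y)%E.
Hypothesis c_fin : forall x : R, x \in `]0, 1[ -> c x \is a fin_num.
Hypothesis c_derivable : forall x : R, x \in `]0, 1[ -> derivable (fine \o c) x 1.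

(** * Two-point lotteries and superharmonic functions *)

Let cf x := fine (c x).

Definition fin_cost : set R := [set x | x \in `[0, 1] /\ c x \is a fin_num].

Lemma fin_cost_itvoo x : x \in `]0, 1[ -> fin_cost x.
Proof. by move=> xI; split; [exact: itvoo_itvcc|exact: c_fin]. Qed.

Lemma cfK x : fin_cost x -> (cf x)%:E = c x.
Proof. by move=> [_ cx]; rewrite /cf fineK. Qed.

Lemma cf_continuous x : x \in `]0, 1[ -> {for x, continuous cf}.
Proof.
move=> xI; apply: differentiable_continuous; apply/derivable1_diffP.
exact: c_derivable.
Qed.

Lemma cf_chord x y q : fin_cost x -> fin_cost y -> x < q < y ->
  (y - x) * cf q <= (y - q) * cf x + (q - x) * cf y.
Proof.
move=> Dx Dy /andP[xq qy]; have yx : 0 < y - x by lra.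
have qI : q \in `]0, 1[.
  case: Dx Dy => + _ [+ _]; rewrite !in_itv/= => /andP[x0 _] /andP[_ y1].
  by rewrite (le_lt_trans x0)//= (lt_le_trans qy).
have tI : (y - q) / (y - x) \in `[0, 1] by apply: weight_itv; rewrite xq.
have := c_convex Dx.1 Dy.1 tI.
rewrite [X in c X](_ : _ = q); last by field; rewrite gt_eqF.
rewrite -(cfK Dx) -(cfK Dy) -(cfK (fin_cost_itvoo qI)) -!EFinM -EFinD lee_fin.
rewrite -(ler_pM2l yx) => /le_trans; apply; rewrite le_eqVlt; apply/orP; left.
by apply/eqP; field; rewrite gt_eqF.
Qed.

(* Net payoff of drawing, at belief [q], the lottery on [{x, y}] of mean [q] when
   the posteriors are worth [zx] and [zy]. *)
Definition gain x y q zx zy :=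
  ((y - q) * (zx - cf x) + (q - x) * (zy - cf y)) / (y - x) + cf q - kappa.

Definition binary_payoff s x y p zx zy :=
  disc uc p s%:E + expR (- r * s) * gain x y (bpath p s) zx zy.

(** The wait is strictly positive because acquisition times strictly increase: a plan that continues
    after an earlier draw cannot draw again at once. Immediate draws are recovered as limits in
    [vstar_chord]. *)
Definition feasible s x y p :=
  [/\ 0 < s, fin_cost x, fin_cost y & x < bpath p s < y].

Lemma le_gain x y q zx zy zx' zy' : x < q < y -> zx <= zx' -> zy <= zy' ->
  gain x y q zx zy <= gain x y q zx' zy'.
Proof.
move=> /andP[xq qy] hx hy; rewrite /gain !lerD2r ler_pM2r ?invr_gt0; last by lra.
by apply: lerD; (apply: ler_wpM2l; [rewrite subr_ge0 ltW|rewrite lerD2r]).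
Qed.

Lemma le_binary_payoff s x y p zx zy zx' zy' : feasible s x y p ->
  zx <= zx' -> zy <= zy' -> binary_payoff s x y p zx zy <= binary_payoff s x y p zx' zy'.
Proof.
move=> [s0 _ _ xy] hx hy; rewrite /binary_payoff lerD2l ler_wpM2l ?expR_ge0//.
exact: le_gain.
Qed.

Definition superharmonic (z : R -> R) :=
  (forall p, p \in `[0, 1] -> vl p <= z p) /\
  (forall p s x y, p \in `[0, 1] -> feasible s x y p ->
     binary_payoff s x y p (z x) (z y) <= z p).

Lemma superharmonic_vb : superharmonic vb.
Proof.
split => [p|p s x y pI [s0 Dx Dy xy]]; first exact: vl_le_vb.
apply: le_trans (vb_split_ge (ltW s0) pI).
rewrite /binary_payoff lerD2l ler_wpM2l ?expR_ge0// /gain.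
have yx : 0 < y - x by lra.
have := vb_chord Dx.1 Dy.1 xy; have := cf_chord Dx Dy xy.
set q := bpath p s => h1 h2.
have kappa0 := kappa_gt0.
suff : ((y - q) * (vb x - cf x) + (q - x) * (vb y - cf y)) / (y - x) <= vb q - cf q by lra.
by rewrite ler_pdivrMr//; lra.
Qed.

Definition vstar p := inf [set z p | z in superharmonic].

Lemma vstar_has_inf p : p \in `[0, 1] -> has_inf [set z p | z in superharmonic].
Proof.
move=> pI; split; first by exists (vb p), vb => //; exact: superharmonic_vb.
by exists (vl p) => _ [z [hz _] <-]; exact: hz.
Qed.

Lemma vstar_le z p : superharmonic z -> p \in `[0, 1] -> vstar p <= z p.
Proof.
move=> hz pI; apply: ge_inf; last by exists z.
by case: (vstar_has_inf pI).
Qed.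

Lemma superharmonic_vstar : superharmonic vstar.
Proof.
split => [p pI|p s x y pI F].
  apply: lb_le_inf; first by case: (vstar_has_inf pI).
  by move=> _ [z [hz _] <-]; exact: hz.
apply: lb_le_inf; first by case: (vstar_has_inf pI).
move=> _ [z sz <-]; apply: le_trans (sz.2 p s x y pI F).
by case: (F) => _ [xI _] [yI _] _; apply: le_binary_payoff => //; exact: vstar_le.
Qed.

Lemma vl_le_vstar p : p \in `[0, 1] -> vl p <= vstar p.
Proof. exact: superharmonic_vstar.1. Qed.

Lemma vstar_le_vb p : p \in `[0, 1] -> vstar p <= vb p.
Proof. by move=> pI; apply: vstar_le => //; exact: superharmonic_vb. Qed.

(* Otherwise lowering [vstar] to [a] at the single point [p] would keep it
   superharmonic. *)
Lemma lt_vstar a p : p \in `[0, 1] -> a < vstar p ->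
  a < vl p \/ exists s x y, feasible s x y p /\
    a < binary_payoff s x y p (vstar x) (vstar y).
Proof.
move=> pI ap; apply: contrapT => /not_orP[nl nB].
have {}nl : vl p <= a by rewrite leNgt; apply/negP.
have {}nB s x y : feasible s x y p -> binary_payoff s x y p (vstar x) (vstar y) <= a.
  by move=> F; rewrite leNgt; apply/negP => h; apply: nB; exists s, x, y.
pose z q := if q == p then a else vstar q.
have zv q : z q <= vstar q by rewrite /z; have [->|//] := eqVneq q p; exact: ltW.
have : vstar p <= z p.
  apply: vstar_le => //; split => [q qI|q s x y qI F].
    by rewrite /z; have [->//|_] := eqVneq q p; exact: vl_le_vstar.
  apply: (le_trans (le_binary_payoff F (zv x) (zv y))).
  rewrite /z; have [qp|_] := eqVneq q p; first by rewrite qp in F *; exact: nB.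
  exact: superharmonic_vstar.2.
by rewrite /z eqxx leNgt ap.
Qed.

Lemma binary_payoff_split s t x y p zx zy : 0 <= t -> 0 <= s ->
  disc uc p t%:E + expR (- r * t) * binary_payoff s x y (bpath p t) zx zy =
  binary_payoff (t + s) x y p zx zy.
Proof.
move=> t0 s0; rewrite /binary_payoff bpathD disc_split// (mulrDr (- r) t) expRD.
by ring.
Qed.

(** Superharmonicity only constrains plans that end in a lottery or never acquire, so pure waiting
    has to be derived: a near-optimal plan at [bpath p t], given by [lt_vstar], becomes a plan at
    [p] when delayed by [t]. *)
Lemma vstar_wait p t : p \in `[0, 1] -> 0 <= t ->
  disc uc p t%:E + expR (- r * t) * vstar (bpath p t) <= vstar p.
Proof.
move=> pI t0; rewrite -lerBrDl mulrC -ler_pdivlMr ?expR_gt0//.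
apply/ler_addgt0Pl => e e0; rewrite -lerBlDl.
have ptI : bpath p t \in `[0, 1] by exact: bpath_itv.
have := @lt_vstar (vstar (bpath p t) - e) _ ptI.
rewrite ltrBlDr ltrDl => /(_ e0)[|[s [x [y [F]]]]] /ltW/le_trans; apply;
  rewrite ler_pdivlMr ?expR_gt0// mulrC lerBrDl.
  by rewrite -vl_split//; exact: vl_le_vstar.
case: F => s0 Dx Dy; rewrite bpathD => xy.
rewrite (binary_payoff_split _ _ _ _ _ t0 (ltW s0)).
by apply: superharmonic_vstar.2 => //; split => //; rewrite ltr_wpDl.
Qed.

Lemma vstar_chord p x y : p \in `]0, 1[ -> fin_cost x -> fin_cost y ->
  x < p < y -> gain x y p (vstar x) (vstar y) <= vstar p.
Proof.
move=> pI Dx Dy /andP[xp py].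
have [K K0 [hK _]] := uc_ubar_bound.
(* [g] minorizes the payoff of waiting [s]: the flow is replaced by its lower bound [- K], whose
   discounted total is explicit and tends to 0 with [s]. *)
pose g s := - (K * ((1 - expR (- r * s)) / r)) +
  expR (- r * s) * gain x y (bpath p s) (vstar x) (vstar y).
have cb : bpath p s @[s --> 0] --> p.
  rewrite -[X in _ --> X](bpath0 lam0 lam1 p).
  exact: (@continuous_bpath_time _ lam0 lam1 p 0).
have ce : expR (- r * s) @[s --> 0] --> (1 : R).
  have -> : 1 = expR (- r * 0) by rewrite mulr0 expR0.
  apply: continuous_comp; last exact: continuous_expR.
  by apply: cvgM; [exact: cvg_cst|exact: cvg_id].
have cg : g s @[s --> 0] --> gain x y p (vstar x) (vstar y).
  have -> : gain x y p (vstar x) (vstar y) =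
    - (K * ((1 - 1) / r)) + 1 * gain x y p (vstar x) (vstar y) by ring.
  apply: cvgD.
    apply: cvgN; apply: cvgM; first exact: cvg_cst.
    by apply: cvgM; [apply: cvgB => //; exact: cvg_cst|exact: cvg_cst].
  apply: cvgM => //; rewrite /gain; apply: cvgB; last exact: cvg_cst.
  apply: cvgD; last by apply: (cvg_comp _ _ cb); exact: cf_continuous.
  apply: cvgM; last exact: cvg_cst.
  by apply: cvgD; (apply: cvgM; last exact: cvg_cst);
    apply: cvgB => //; exact: cvg_cst.
rewrite leNgt; apply/negP => vlt.
have : \forall s \near (0 : R), [/\ vstar p < g s, x < bpath p s & bpath p s < y].
  by near=> s; split; near: s; [exact: (cvgr_gt _ cg)|exact: (cvgr_gt _ cb)|
    exact: (cvgr_lt _ cb)].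
move=> /nbhs_ballP[e /= e0 /(_ (e / 2))].
rewrite /ball/= sub0r normrN ger0_norm ?divr_ge0 ?ltW// => /(_ _)[].
  by rewrite ltr_pdivrMr// ltr_pMr// ltr1n.
move=> h xb by_; move: h; apply/negP; rewrite -leNgt.
have pI' := itvoo_itvcc pI.
have F : feasible (e / 2) x y p by split => //; rewrite ?xb ?by_// divr_gt0.
apply: le_trans (superharmonic_vstar.2 _ _ _ _ pI' F).
rewrite /g /binary_payoff lerD2r.
have e2 : 0 <= e / 2 by rewrite divr_ge0// ltW.
rewrite -(disc_one_fin lam0 lam1 r_gt0 p e2).
have := disc_bound lam0 lam1 r_gt0 p (e / 2)%:E uc_continuous hK.
by rewrite ler_norml => /andP[].
Unshelve. all: by end_near. Qed.

(** * From two-point lotteries to Bayes plausible distributions *)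

Local Notation I01 := (`[0%R, 1%R]%classic : set R).

Lemma measurable_c : measurable_fun I01 c.
Proof.
have -> : I01 = `]0, 1[%classic `|` ([set 0] `|` [set 1]).
  apply/seteqP; split => x /=.
    by move=> /itvcc_cases[->|->|]; [right; left|right; right|left].
  by move=> [/itvoo_itvcc//|[->|->]]; rewrite in_itv/= lexx ler01.
apply/measurable_funU => //; first exact: measurableU.
split; last first.
  by apply/measurable_funU => //; split; exact: measurable_fun_set1.
apply: (@eq_measurable_fun _ _ _ _ _ (EFin \o cf)).
  by move=> x; rewrite inE => /fin_cost_itvoo/cfK <-.
apply/measurable_EFinP; apply: open_continuous_measurable_fun.
  exact: interval_open.
by move=> x; rewrite inE; exact: cf_continuous.
Qed.

Lemma measurable_cB q : measurable_fun I01 (fun x => (c x - (cf q)%:E)%E).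
Proof. by apply: emeasurable_funB => //; exact: measurable_c. Qed.

Lemma Ccost_itvoo q F : q \in `]0, 1[ ->
  Ccost c q F = (\int[F]_(x in I01) (c x - (cf q)%:E))%E.
Proof. by move=> qI; rewrite /Ccost c_fin// cfK//; exact: fin_cost_itvoo. Qed.

Lemma Ccost_endpoint q F : q = 0 \/ q = 1 -> inB q F -> Ccost c q F = 0%E.
Proof.
move=> q01 FB; rewrite /Ccost; case: ifPn => // cq.
rewrite (inB_endpoint q01 FB) ?subee//.
by apply: emeasurable_funB => //; exact: measurable_c.
Qed.

(* Concave-envelope argument: if all two-point lotteries yield at most [M], then
   [w - c] lies below an affine function taking the right value at [q], and so
   does its average under any [F] with mean [q]. *)
Lemma binary_suffices (w : R -> R) K q M : measurable_fun I01 w ->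
  (forall x, x \in `[0, 1] -> `|w x| <= K) -> q \in `]0, 1[ ->
  (forall x y, fin_cost x -> fin_cost y -> x < q < y -> gain x y q (w x) (w y) <= M) ->
  w q - kappa <= M ->
  forall F, inB q F ->
  (\int[F]_(x in I01) (w x)%:E - Ccost c q F - kappa%:E <= M%:E)%E.
Proof.
move=> mw wK qI hg wq F FB.
have [q0 q1] : 0 < q /\ q < 1 by move: qI; rewrite in_itv/= => /andP.
have h2 : q / 2 \in `]0, 1[ by rewrite in_itv/=; apply/andP; split; lra.
have h3 : (q + 1) / 2 \in `]0, 1[ by rewrite in_itv/=; apply/andP; split; lra.
have [m hm] : exists m, forall x, fin_cost x ->
    w x - cf x <= (M + kappa - cf q) + m * (x - q).
  apply: supporting_line.
  - by exists (q / 2); [exact: fin_cost_itvoo|lra].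
  - by exists ((q + 1) / 2); [exact: fin_cost_itvoo|lra].
  - by move=> _; lra.
  - move=> x y Dx Dy xq qy; have yx : 0 < y - x by lra.
    have := hg x y Dx Dy; rewrite xq qy => /(_ isT).
    rewrite /gain => h.
    have : ((y - q) * (w x - cf x) + (q - x) * (w y - cf y)) / (y - x)
      <= M + kappa - cf q by lra.
    by rewrite ler_pdivrMr.
have iw : F.-integrable I01 (EFin \o w) by apply: (@bounded_integrable _ _ _ _ _ _ K).
pose g x := w x + (- (M + kappa - m * q) + - m * x).
have ig' : F.-integrable I01 (EFin \o (fun x => - (M + kappa - m * q) + - m * x)).
  apply: (@bounded_integrable _ _ _ _ _ _ (`|M + kappa - m * q| + `|m|)) => //.
    by apply: measurable_funD => //; apply: measurable_funM => //; exact: measurable_id.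
  move=> x /=; rewrite in_itv/= => /andP[x0 x1].
  rewrite (le_trans (ler_normD _ _))// normrN lerD2l normrM normrN ler_piMr//.
  by rewrite ger0_norm.
have ig : F.-integrable I01 (EFin \o g) by exact: integrable_EFinD.
have gE : (\int[F]_(x in I01) (g x)%:E = \int[F]_(x in I01) (w x)%:E - (M + kappa)%:E)%E.
  rewrite /g; under eq_integral do rewrite EFinD.
  rewrite integralD// (inB_affine _ _ FB); congr (_ + _)%E.
  by rewrite -EFinN; congr EFin; ring.
have : (\int[F]_(x in I01) (g x)%:E <= Ccost c q F)%E.
  rewrite Ccost_itvoo//.
  apply: le_integral_integrable_left => //; first exact: measurable_cB.
  (* Where [c] is infinite the inequality is trivial; this is why the supporting line was only
     sought on [fin_cost]. *)
  move=> x xI; have [cx|] := boolP (c x \is a fin_num).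
    have Dx : fin_cost x by split.
    by rewrite -(cfK Dx) -EFinB lee_fin /g; have := hm x Dx; lra.
  by rewrite ge0_fin_numE ?c_ge0// -leNgt leye_eq => /eqP ->; rewrite addye// leey.
rewrite gE -(fineK (integrable_fin_num _ iw))//.
case: (Ccost c q F) => [C||]; rewrite ?leeNy_eq//=.
  by rewrite -!EFinB !lee_fin; lra.
by rewrite addeNy addNye leNye.
Qed.

(** Jensen's inequality for an extended-valued [c], read off [binary_suffices] with zero
    continuation value: by convexity every two-point gain is at most [- kappa]. *)
Lemma Ccost_ge0 q F : q \in `[0, 1] -> inB q F -> (0 <= Ccost c q F)%E.
Proof.
move=> /itvcc_cases[q01|q01|qI] FB.
- by rewrite Ccost_endpoint//; left.
- by rewrite Ccost_endpoint//; right.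
have := @binary_suffices (cst 0) 0 q (- kappa) _ _ qI _ _ F FB.
rewrite integral0 add0e => H.
have {H} : (- Ccost c q F - kappa%:E <= (- kappa)%:E)%E.
  apply: H => //.
  - by move=> x _; rewrite normr0.
  - move=> x y Dx Dy xy; have := cf_chord Dx Dy xy; move: xy => /andP[xq qy].
    have yx : 0 < y - x by lra.
    rewrite /gain /= !sub0r => h.
    suff : ((y - q) * - cf x + (q - x) * - cf y) / (y - x) <= - cf q by lra.
    by rewrite ler_pdivrMr//; lra.
  - by rewrite sub0r.
case: (Ccost c q F) => [C||]//=.
by rewrite -EFinD !lee_fin; lra.
Qed.

Lemma acquire_endpoint (w : R -> R) q F : measurable_fun I01 w ->
  q = 0 \/ q = 1 -> inB q F ->
  (\int[F]_(x in I01) (w x)%:E - Ccost c q F - kappa%:E = (w q - kappa)%:E)%E.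
Proof.
move=> mw q01 FB; rewrite Ccost_endpoint// (inB_endpoint q01 FB); last exact/measurable_EFinP.
by rewrite sube0 EFinB.
Qed.

Lemma Ccost_lottery x y q (h : x < q < y) : fin_cost x -> fin_cost y ->
  Ccost c q (lottery h) = (((y - q) * cf x + (q - x) * cf y) / (y - x) - cf q)%:E.
Proof.
move=> Dx Dy; have /andP[xq qy] := h; have yx : 0 < y - x by lra.
have qI : q \in `]0, 1[.
  case: Dx Dy => + _ [+ _]; rewrite !in_itv/= => /andP[x0 _] /andP[_ y1].
  by rewrite (le_lt_trans x0)//= (lt_le_trans qy).
rewrite Ccost_itvoo// integral_lottery//; last 5 first.
- exact: Dx.1.
- exact: Dy.1.
- exact: measurable_cB.
- by rewrite -(cfK Dx).
- by rewrite -(cfK Dy).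
rewrite -(cfK Dx) -(cfK Dy) /=; congr EFin.
by field; rewrite gt_eqF.
Qed.

Lemma gain_lottery (w : R -> R) x y q (h : x < q < y) : measurable_fun I01 w ->
  fin_cost x -> fin_cost y ->
  (\int[lottery h]_(z in I01) (w z)%:E - Ccost c q (lottery h) - kappa%:E
   = (gain x y q (w x) (w y))%:E)%E.
Proof.
move=> mw Dx Dy; have /andP[xq qy] := h; have yx : 0 < y - x by lra.
rewrite Ccost_lottery// integral_lottery//; last 3 first.
- exact: Dx.1.
- exact: Dy.1.
- exact/measurable_EFinP.
rewrite -!EFinB /gain /=; congr EFin.
by field; rewrite gt_eqF.
Qed.

Lemma disc_uc_continuous tau : continuous (fun p => disc uc p tau).
Proof.
have [L L0 hL] := uc_dist; have [K K0 [hK _]] := uc_ubar_bound.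
apply: (@dist_continuous _ _ (L / r)) => p p'.
exact: (@disc_dist _ lam0 lam1 r lam0_gt0 lam1_gt0 r_gt0 uc K L p p' tau uc_continuous hK L0 hL).
Qed.

Lemma binary_payoff_continuous s x y zx zy (p : R) : p \in `[0, 1] ->
  feasible s x y p ->
  {for p, continuous (fun p' => binary_payoff s x y p' zx zy)}.
Proof.
move=> pI [s0 Dx Dy /andP[xp py]].
have cb : bpath p' s @[p' --> p] --> bpath p s.
  exact: (@continuous_bpath_belief _ lam0 lam1 s p).
have qI : bpath p s \in `]0, 1[ by exact: bpath_itvoo.
apply: cvgD; first exact: disc_uc_continuous.
apply: cvgM; first exact: cvg_cst.
rewrite /gain; apply: cvgB; last exact: cvg_cst.
apply: cvgD; last by apply: (cvg_comp _ _ cb); exact: cf_continuous.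
apply: cvgM; last exact: cvg_cst.
by apply: cvgD; (apply: cvgM; last exact: cvg_cst);
  apply: cvgB => //; exact: cvg_cst.
Qed.

(* [vstar] is lower semicontinuous, as a supremum of functions that are
   continuous where they are feasible. *)
Lemma measurable_vstar : measurable_fun I01 vstar.
Proof.
apply: (measurability _ (RGenOInfty.measurableE R)) => //.
move=> _ [_ [a ->] <-].
(* The implication puts every point outside the unit interval into [S], so that at an endpoint only
   the inner side has to be checked for [S] to be a neighbourhood. *)
pose S : set R := [set p | p \in `[0, 1] -> a < vstar p].
rewrite (_ : I01 `&` _ = I01 `&` S°).
  by apply: measurableI => //; apply: open_measurable; exact: open_interior.
apply/seteqP; split => p [pI] /=.
  rewrite in_itv/= andbT => ap; split => //.
  have [al|[s [x [y [F aB]]]]] := lt_vstar pI ap.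
    apply: filterS (cvgr_gt _ (disc_uc_continuous (tau := +oo%E) (x := p)) _ al).
    move=> p' ap' p'I; apply: (lt_le_trans ap'); exact: vl_le_vstar.
  have cb : bpath p' s @[p' --> p] --> bpath p s.
    exact: (@continuous_bpath_belief _ lam0 lam1 s p).
  case: (F) => s0 Dx Dy /andP[xp py].
  have h1 : \forall p' \near p, x < bpath p' s by exact: (cvgr_gt _ cb).
  have h2 : \forall p' \near p, bpath p' s < y by exact: (cvgr_lt _ cb).
  have h3 : \forall p' \near p, a < binary_payoff s x y p' (vstar x) (vstar y).
    exact: (cvgr_gt _ (@binary_payoff_continuous s x y (vstar x) (vstar y) p pI F)).
  apply: filterS3 h1 h2 h3 => p' xp' py' ap' p'I; apply: (lt_le_trans ap').
  by apply: superharmonic_vstar.2 => //; split => //; rewrite xp' py'.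
by move=> /interior_subset/(_ pI) ap; split => //=; rewrite in_itv/= ap.
Qed.

Lemma vstar_bound : exists M, forall p, p \in `[0, 1] -> `|vstar p| <= M.
Proof.
have [K K0 [hK hK']] := uc_ubar_bound.
exists (K / r) => p pI.
have := disc_bound lam0 lam1 r_gt0 p +oo uc_continuous hK.
have := disc_bound lam0 lam1 r_gt0 p +oo ubar_continuous hK'.
rewrite disc_one// !ler_norml => /andP[_ h1] /andP[h2 _].
by rewrite (le_trans h2 (vl_le_vstar pI)) (le_trans (vstar_le_vb pI) h1).
Qed.

(** At an endpoint [F] is degenerate and [vstar_wait] suffices; inside, [binary_suffices] reduces
    [F] to two-point lotteries. The bound is solved for the continuation payoff because that payoff
    may be [-oo]. *)
Lemma vstar_acquire p t F : p \in `[0, 1] -> 0 <= t -> inB (bpath p t) F ->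
  (\int[F]_(x in I01) (vstar x)%:E - Ccost c (bpath p t) F - kappa%:E
   <= ((vstar p - disc uc p t%:E) / expR (- r * t))%:E)%E.
Proof.
move=> pI t0 FB; have [M hM] := vstar_bound.
have kappa0 := kappa_gt0.
have vw : vstar (bpath p t) <= (vstar p - disc uc p t%:E) / expR (- r * t).
  by rewrite ler_pdivlMr ?expR_gt0// mulrC lerBrDl; exact: vstar_wait.
have vwk : vstar (bpath p t) - kappa <= (vstar p - disc uc p t%:E) / expR (- r * t).
  by lra.
have qI : bpath p t \in `[0, 1] by exact: bpath_itv.
have [q01|q01|qoo] := itvcc_cases qI.
- by rewrite acquire_endpoint//; [exact: measurable_vstar|left].
- by rewrite acquire_endpoint//; [exact: measurable_vstar|right].
apply: (binary_suffices measurable_vstar hM qoo) => // x y Dx Dy xy.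
(* Superharmonicity covers positive waits only, so [t = 0] relies on the limit argument of
   [vstar_chord]. *)
move: t0; rewrite le_eqVlt => /predU1P[t0|t0].
  rewrite -t0 bpath0 in qoo xy *; rewrite mulr0 expR0 divr1.
  rewrite /disc before_fin set_itvco0 Rintegral_set0 subr0.
  exact: vstar_chord.
rewrite ler_pdivlMr ?expR_gt0// mulrC lerBrDl.
exact: superharmonic_vstar.2.
Qed.

(** * The Bellman equation for the least superharmonic function *)

Lemma inner_ge_dirac (w : R -> R) q : measurable_fun I01 w -> q \in `[0, 1] ->
  ((w q - kappa)%:E <= inner kappa c w q)%E.
Proof.
move=> mw qI; apply: ereal_sup_ubound; exists (\d_ q : probability R R).
  exact: inB_dirac.
have -> : Ccost c q (\d_ q : probability R R) = 0%E.
  rewrite /Ccost; case: ifPn => // cq; rewrite integral_dirac//.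
    by rewrite subee// mule0.
  by apply: emeasurable_funB => //; exact: measurable_c.
rewrite integral_dirac//; last exact/measurable_EFinP.
by rewrite diracE mem_set// mul1e sube0 EFinB.
Qed.

Lemma inner_ge_lottery (w : R -> R) x y q : measurable_fun I01 w ->
  fin_cost x -> fin_cost y -> x < q < y ->
  ((gain x y q (w x) (w y))%:E <= inner kappa c w q)%E.
Proof.
move=> mw Dx Dy h; apply: ereal_sup_ubound; exists (lottery h).
  by apply: inB_lottery; [exact: Dx.1|exact: Dy.1].
exact: gain_lottery.
Qed.

Lemma bellman_rhs_ge (w : R -> R) p t M : p \in `[0, 1] -> 0 <= t ->
  (M%:E <= inner kappa c w (bpath p t))%E ->
  ((disc uc p t%:E + expR (- r * t) * M)%:E
   <= bellman_rhs lam0 lam1 r kappa ut c w p)%E.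
Proof.
move=> pI t0 hM; apply: le_trans; last first.
  by apply: ereal_sup_ubound; exists t; [rewrite /= in_itv/= t0|reflexivity].
by rewrite integral_u_itv// EFinD leeD2l// EFinM lee_wpmul2l.
Qed.

Lemma bellman_rhs_le (w : R -> R) p M : p \in `[0, 1] ->
  (forall t F, 0 <= t -> inB (bpath p t) F ->
    (\int[F]_(x in I01) (w x)%:E - Ccost c (bpath p t) F - kappa%:E
     <= ((M - disc uc p t%:E) / expR (- r * t))%:E)%E) ->
  (bellman_rhs lam0 lam1 r kappa ut c w p <= M%:E)%E.
Proof.
move=> pI hM; apply: ge_ereal_sup => z [t] /=; rewrite in_itv/= andbT => t0 <-.
rewrite integral_u_itv//.
have : (inner kappa c w (bpath p t) <= ((M - disc uc p t%:E) / expR (- r * t))%:E)%E.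
  by apply: ge_ereal_sup => z' [F FB <-]; exact: hM.
move=> /(lee_wpmul2l (x := (expR (- r * t))%:E)).
rewrite lee_fin expR_ge0 => /(_ isT) /(leeD2l (disc uc p t%:E)%:E) /le_trans; apply.
rewrite -EFinM -EFinD lee_fin mulrCA divff ?gt_eqF ?expR_gt0// mulr1.
by rewrite addrC subrK.
Qed.

(** The supremum runs over finite waiting times and has no term for never acquiring; that payoff is
    approached by a very late uninformative acquisition, whose fixed cost is discounted away. *)
Lemma vl_le_bellman_rhs (w : R -> R) p : measurable_fun I01 w ->
  (forall q, q \in `[0, 1] -> vl q <= w q) -> p \in `[0, 1] ->
  ((vl p)%:E <= bellman_rhs lam0 lam1 r kappa ut c w p)%E.
Proof.
move=> mw vlw pI; apply/lee_addgt0Pr => e e0; rewrite -leeBlDr// -EFinB.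
have kappa0 := kappa_gt0; have r0 := r_gt0.
(* Chosen so that [r * t = kappa / e]; then [expR (r * t) >= 1 + r * t] brings the discounted fixed
   cost below [e]. *)
pose t := kappa / e / r.
have t0 : 0 <= t by rewrite !divr_ge0// ltW.
have qI : bpath p t \in `[0, 1] by exact: bpath_itv.
have := bellman_rhs_ge pI t0 (inner_ge_dirac mw qI).
apply: le_trans; rewrite lee_fin (vl_split p t0) mulrBr addrA.
have h1 : expR (- r * t) * vl (bpath p t) <= expR (- r * t) * w (bpath p t).
  by rewrite ler_wpM2l ?expR_ge0// vlw.
suff : expR (- r * t) * kappa <= e by lra.
rewrite mulNr expRN mulrC ler_pdivrMr ?expR_gt0//.
have h2 := expR_ge1Dx (r * t).
have h3 : r * t = kappa / e by rewrite /t; field; rewrite !gt_eqF.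
apply: (@le_trans _ _ (e * (1 + r * t))); last by rewrite ler_wpM2l// ltW.
rewrite h3 mulrDr mulr1 mulrCA divff ?gt_eqF// mulr1; lra.
Qed.

(** Minimality supplies the lower half: [lt_vstar] approximates [vstar p] by the no-information
    value or by a two-point plan, and the right-hand side of the equation dominates both. *)
Lemma solves_bellman_vstar : solves_bellman lam0 lam1 r kappa ut c vstar.
Proof.
move=> p pI; apply/eqP; rewrite eq_le; apply/andP; split; last first.
  by apply: bellman_rhs_le => // t F t0 FB; exact: vstar_acquire.
apply/lee_addgt0Pr => e e0; rewrite -leeBlDr// -EFinB.
have := @lt_vstar (vstar p - e) _ pI.
rewrite ltrBlDr ltrDl => /(_ e0)[|[s [x [y [[s0 Dx Dy xy] ]]]]] al.
  apply: le_trans (vl_le_bellman_rhs measurable_vstar vl_le_vstar pI).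
  by rewrite lee_fin ltW.
have := bellman_rhs_ge pI (ltW s0) (inner_ge_lottery measurable_vstar Dx Dy xy).
by apply: le_trans; rewrite lee_fin; exact: ltW.
Qed.

Lemma superharmonic_solution (w : R -> R) : measurable_fun I01 w ->
  (forall q, q \in `[0, 1] -> vl q <= w q) ->
  solves_bellman lam0 lam1 r kappa ut c w -> superharmonic w.
Proof.
move=> mw vlw sw; split => // p s x y pI [s0 Dx Dy xy].
rewrite -lee_fin sw//.
exact: (bellman_rhs_ge pI (ltW s0) (inner_ge_lottery mw Dx Dy xy)).
Qed.

(** * Uniqueness of the solution *)

Lemma integral_vb q F : inB q F -> q \in `[0, 1] ->
  (\int[F]_(x in I01) (vb x)%:E = (vb q)%:E)%E.
Proof.
have I0 : (0 : R) \in `[0, 1] by rewrite in_itv/= lexx ler01.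
have I1 : (1 : R) \in `[0, 1] by rewrite in_itv/= lexx ler01.
have vbE x : x \in `[0, 1] -> vb x = vb 0 + (vb 1 - vb 0) * x.
  by move=> xI; have := vb_affine xI I1 I0; rewrite !(mulr1, mulr0, addr0) => ->; ring.
move=> FB qI; rewrite [in RHS]vbE// -(inB_affine _ _ FB).
by apply: eq_integral => x; rewrite inE => xI; rewrite vbE.
Qed.

(* [vstar + a (vb + kappa - vstar)] majorizes a solution [w]; the fixed cost makes
   the Bellman operator map [vb + kappa] below [vb], which shrinks [a]. *)
Lemma solution_le_step (w : R -> R) a : measurable_fun I01 w ->
  (exists M, forall p, p \in `[0, 1] -> `|w p| <= M) ->
  solves_bellman lam0 lam1 r kappa ut c w -> 0 <= a <= 1 ->
  (forall p, p \in `[0, 1] -> w p <= vstar p + a * (vb p + kappa - vstar p)) ->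
  forall p, p \in `[0, 1] -> w p <= vstar p + a * (vb p - vstar p).
Proof.
move=> mw [Mw hMw] sw /andP[a0 a1] wa p pI.
rewrite -lee_fin sw//; apply: bellman_rhs_le => // t F t0 FB.
have qI : bpath p t \in `[0, 1] by exact: bpath_itv.
have := vstar_acquire pI t0 FB; have C0 := Ccost_ge0 qI FB.
have [M hM] := vstar_bound.
have iw : F.-integrable I01 (EFin \o w) by apply: (@bounded_integrable _ _ _ _ _ _ Mw).
have iv : F.-integrable I01 (EFin \o vstar).
  by apply: (@bounded_integrable _ _ _ _ _ _ M) => //; exact: measurable_vstar.
have [K K0 [hK hK']] := uc_ubar_bound.
have ib : F.-integrable I01 (EFin \o vb).
  have I0 : (0 : R) \in `[0, 1] by rewrite in_itv/= lexx ler01.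
  have I1 : (1 : R) \in `[0, 1] by rewrite in_itv/= lexx ler01.
  apply: (@bounded_integrable _ _ _ _ _ _ (K / r)) => //.
    apply: (@eq_measurable_fun _ _ _ _ _ (fun x => vb 0 + (vb 1 - vb 0) * x)).
      move=> x; rewrite inE => xI; have := vb_affine xI I1 I0.
      by rewrite !(mulr1, mulr0, addr0) => ->; ring.
    by apply: measurable_funD => //; apply: measurable_funM => //; exact: measurable_id.
  move=> x _; have := disc_bound lam0 lam1 r_gt0 x +oo ubar_continuous hK'.
  by rewrite disc_one.
have ik : F.-integrable I01 (EFin \o (fun=> kappa)).
  by apply: (@bounded_integrable _ _ _ _ _ _ `|kappa|).
have iz : F.-integrable I01 (EFin \o (fun x => (1 - a) * vstar x + a * (vb x + kappa))).
  by apply: integrable_EFinD => //; apply: integrable_EFinZl => //; exact: integrable_EFinD.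
(* The right-hand side is the [F]-average of the majorant of [w]: being affine, [vb] averages to its
   value at the mean. *)
have wz : (\int[F]_(x in I01) (w x)%:E <=
    (1 - a)%:E * \int[F]_(x in I01) (vstar x)%:E + (a * (vb (bpath p t) + kappa))%:E)%E.
  have -> : ((1 - a)%:E * \int[F]_(x in I01) (vstar x)%:E +
      (a * (vb (bpath p t) + kappa))%:E =
      \int[F]_(x in I01) ((1 - a) * vstar x + a * (vb x + kappa))%:E)%E.
    have ibk := integrable_EFinD (measurable_itv _) ib ik.
    have vbk : (\int[F]_(x in I01) (vb x + kappa)%:E = (vb (bpath p t) + kappa)%:E)%E.
      under eq_integral do rewrite EFinD.
      rewrite integralD// (integral_vb FB qI) [X in (_ + X)%E](integral_cst F (measurable_itv _)).
      by rewrite [X in (_ * X)%E]FB.1 mule1.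
    under [RHS]eq_integral do rewrite EFinD (EFinM (1 - a)) (EFinM a).
    rewrite integralD//; try exact: integrableZl.
    by rewrite !integralZl// vbk EFinM.
  apply: le_integral => // x; rewrite inE => xI; rewrite lee_fin.
  by have := wa x xI; lra.
move: wz.
rewrite -(fineK (integrable_fin_num _ iv))// -(fineK (integrable_fin_num _ iw))//.
case: (Ccost c _ F) C0 => [C||]//=; last by move=> _ _ _; rewrite addeNy addNye leNye.
rewrite -!EFinM -!EFinD !lee_fin => C0 h1.
rewrite !ler_pdivlMr ?expR_gt0// => h2.
have h3 := vb_split_ge t0 pI.
set e := expR (- r * t) in h2 h3 *; have e0 : 0 < e by exact: expR_gt0.
set W := fine _ in h1 *; set V := fine _ in h1 h2.
set q := bpath p t in h1 h3.
(* The net payoff is shared with weights [1 - a] and [a]. In the second share the fixed cost cancels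
   the [kappa] added to [vb], and the variable cost is dropped since [C >= 0]. *)
apply: (@le_trans _ _ (((1 - a) * (V - C - kappa) + a * vb q) * e)).
  by rewrite ler_wpM2r ?(ltW e0)//; nra.
have : (1 - a) * ((V - C - kappa) * e) <= (1 - a) * (vstar p - disc uc p t%:E).
  by rewrite ler_wpM2l// subr_ge0.
have : a * (e * vb q) <= a * (vb p - disc uc p t%:E).
  by rewrite ler_wpM2l// lerBrDl.
lra.
Qed.

Lemma solution_eq_vstar (w : R -> R) : inV lam0 lam1 r ut w ->
  solves_bellman lam0 lam1 r kappa ut c w ->
  forall p, p \in `[0, 1] -> w p = vstar p.
Proof.
move=> [mw [bw wV]] sw p pI; apply/eqP; rewrite eq_le; apply/andP; split; last first.
  apply: vstar_le => //; apply: superharmonic_solution => // q qI.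
  by have := wV q qI; rewrite vlowE// lee_fin => /andP[].
have wvb q : q \in `[0, 1] -> w q <= vb q.
  by move=> qI; have := wV q qI; rewrite vbarE// lee_fin => /andP[].
have [K K0 [hK hK']] := uc_ubar_bound; have kappa0 := kappa_gt0.
have [M hM] := vstar_bound.
have vbK q : vb q <= K / r.
  have := disc_bound lam0 lam1 r_gt0 q +oo ubar_continuous hK'.
  by rewrite disc_one// ler_norml => /andP[].
pose B := `|K / r| + `|M| + kappa.
have B0 : 0 < B by rewrite /B; have := normr_ge0 (K / r); have := normr_ge0 M; lra.
have dB q : q \in `[0, 1] -> 0 <= vb q + kappa - vstar q <= B.
  move=> qI; have := vstar_le_vb qI; have := vbK q; have := hM q qI.
  rewrite ler_norml => /andP[h1 _] h2 h3.
  have := ler_norm (K / r); have := ler_norm M; rewrite /B => *.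
  by apply/andP; split; lra.
(* The gap [vb + kappa - vstar] is at most [B], so removing [kappa] removes at least the fraction
   [d] of it. The summand [kappa] in [B] ensures [d <= 1]. *)
pose d := kappa / B.
have d01 : 0 < d <= 1.
  rewrite /d divr_gt0//= ler_pdivrMr// mul1r /B.
  by have := normr_ge0 (K / r); have := normr_ge0 M; lra.
have [d0 d1] := andP d01.
have step n : forall q, q \in `[0, 1] ->
    w q <= vstar q + (1 - d) ^+ n * (vb q + kappa - vstar q).
  elim: n => [|n IH] q qI.
    by rewrite expr0 mul1r; have := wvb q qI; lra.
  have a01 : 0 <= (1 - d) ^+ n <= 1.
    by rewrite exprn_ge0 ?subr_ge0//= exprn_ile1 ?subr_ge0// gerBl ltW.
  apply: (le_trans (solution_le_step mw bw sw a01 IH qI)).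
  rewrite lerD2l exprSr -mulrA ler_wpM2l ?exprn_ge0 ?subr_ge0//.
  have /andP[_ h] := dB q qI.
  have : d * (vb q + kappa - vstar q) <= kappa.
    by rewrite /d mulrAC ler_pdivrMr// ler_wpM2l// ltW.
  lra.
have cv : (fun n => vstar p + (1 - d) ^+ n * (vb p + kappa - vstar p)) @ \oo --> vstar p.
  rewrite -[X in _ --> X]addr0; apply: cvgD; first exact: cvg_cst.
  rewrite -[X in _ --> X](mul0r (vb p + kappa - vstar p)).
  apply: cvgM; last exact: cvg_cst.
  by apply: cvg_expr; rewrite ger0_norm ?subr_ge0// gtrBl.
rewrite -(cvg_lim _ cv)//; apply: limr_ge; first by apply/cvg_ex; exists (vstar p).
by apply: nearW => n; exact: step.
Qed.

Lemma inV_vstar : inV lam0 lam1 r ut vstar.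
Proof.
split; first exact: measurable_vstar; split; first exact: vstar_bound.
by move=> p pI; rewrite vlowE// vbarE// !lee_fin vl_le_vstar// vstar_le_vb.
Qed.

(** The test matters: [fine] sends [+oo] to 0, which would give an acquisition that never happens
    the discount factor 1 instead of 0. *)
Definition ed (t : \bar R) : R := if (t < +oo)%E then expR (- r * fine t) else 0.

Lemma ed_ge0 t : 0 <= ed t.
Proof. by rewrite /ed; case: ifP => // _; exact: expR_ge0. Qed.

Lemma measurable_ed : measurable_fun setT ed.
Proof.
apply: measurable_fun_ifT.
- by apply: measurable_fun_lte => //; exact: measurable_cst.
- apply: measurableT_comp; first exact: measurable_expR.
  by apply: measurable_funM => //; exact: fine_measurable.
- exact: measurable_cst.
Qed.

(** * The value is at most the least superharmonic function *)

Section shifted.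
Variable K : R.
Hypotheses (K_ge0 : 0 <= K) (uc_K : forall x, `|uc x| <= K)
  (ubar_K : forall x, `|ubar x| <= K).

Let L : R := K / r.

Let L_ge0 : 0 <= L. Proof. by rewrite divr_ge0// ltW. Qed.

(* Shifting the flow payoff by [K] makes it nonnegative and shifts all values
   by [L = K / r]. *)
Definition ush x : R := uc x + K.

Lemma ush_ge0 x : 0 <= ush x.
Proof. by have := uc_K x; rewrite ler_norml /ush => /andP[]; lra. Qed.

Lemma ush_continuous : continuous ush.
Proof. by move=> x; apply: cvgD; [exact: uc_continuous|exact: cvg_cst]. Qed.

Lemma ush_bound x : `|ush x| <= K + K.
Proof. by rewrite (le_trans (ler_normD _ _))// lerD// ger0_norm. Qed.

Lemma disc_ush_ge0 q t : 0 <= disc ush q t.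
Proof.
by apply: Rintegral_ge0 => s _; rewrite mulr_ge0 ?expR_ge0 ?ush_ge0.
Qed.

Lemma disc_one_ed q t : (0 <= t)%E -> disc (fun=> 1) q t = (1 - ed t) / r.
Proof.
case: t => [s||]//; first by rewrite lee_fin => s0; rewrite disc_one_fin// /ed ltry.
by move=> _; rewrite disc_one// /ed ltxx subr0 mul1r.
Qed.

Lemma disc_ush q t : (0 <= t)%E -> disc ush q t = disc uc q t + L * (1 - ed t).
Proof.
move=> t0.
have c1 : continuous (fun _ : R => 1 : R) by move=> x; exact: cvg_cst.
have b1 : forall x : R, `|(1 : R)| <= 1 by move=> _; rewrite normr1.
transitivity (disc (fun x => 1 * uc x + K * 1) q t).
  by congr disc; apply/funext => x; rewrite /ush mul1r mulr1.
rewrite (@disc_lin _ lam0 lam1 r r_gt0 uc (fun=> 1) K 1)//; last exact: uc_continuous.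
by rewrite disc_one_ed// /L; field; rewrite gt_eqF.
Qed.

(** Extended by 0 off the unit interval, so as to be a bounded nonnegative measurable function on
    the whole line, as [integral_average] requires. *)
Definition vsh : R -> \bar R := (fun x => (vstar x + L)%:E) \_ I01.

Lemma vstar_L_bounds x : x \in `[0, 1] -> 0 <= vstar x + L <= L + L.
Proof.
move=> xI; have := vl_le_vstar xI; have := vstar_le_vb xI.
have := disc_bound lam0 lam1 r_gt0 x +oo uc_continuous uc_K.
have := disc_bound lam0 lam1 r_gt0 x +oo ubar_continuous ubar_K.
rewrite disc_one// -/L !ler_norml -/(vl x) -/(vb x) => /andP[_ h1] /andP[h2 _] h3 h4.
by apply/andP; split; lra.
Qed.

Lemma vsh_itv x : x \in `[0, 1] -> vsh x = (vstar x + L)%:E.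
Proof. by move=> xI; rewrite /vsh patchT// inE. Qed.

Lemma ge0_measurable_vsh : ge0_measurable vsh.
Proof.
split.
  apply: (measurable_restrictT _ _).1 => //; apply/measurable_EFinP.
  by apply: measurable_funD => //; exact: measurable_vstar.
move=> x; rewrite /vsh /patch; case: ifPn => // /set_mem xI.
by rewrite lee_fin; case/andP: (vstar_L_bounds xI).
Qed.

Lemma vsh_le x : (vsh x <= (L + L)%:E)%E.
Proof.
rewrite /vsh /patch; case: ifPn => [/set_mem xI|_]; rewrite lee_fin ?addr_ge0//.
by case/andP: (vstar_L_bounds xI).
Qed.

Lemma integral_vsh q G : inB q G -> (\int[G]_x vsh x =
  \int[G]_(x in I01) (vstar x)%:E + L%:E)%E.
Proof.
move=> GB; rewrite /vsh -integral_mkcond.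
have [M hM] := vstar_bound.
under eq_integral do rewrite EFinD.
rewrite integralD//; last 2 first.
- by apply: (@bounded_integrable _ _ _ _ _ _ M) => //; exact: measurable_vstar.
- by apply: (@bounded_integrable _ _ _ _ _ (cst L) `|L|).
rewrite [X in (_ + X)%E](integral_cst G (measurable_itv _)).
by rewrite [X in (_ * X)%E]GB.1 mule1.
Qed.

(** The cost stands additively on the right, so an infinite cost makes the inequality trivial
    instead of indeterminate. For [t = +oo] it reduces to [vl <= vstar]. *)
Lemma one_step q t G : q \in `[0, 1] -> (0 <= t)%E ->
  ((t < +oo)%E -> inB (bpath q (fine t)) G) ->
  ((disc ush q t)%:E + (ed t)%:E * \int[G]_x vsh x <=
   vsh q + (ed t)%:E * (if (t < +oo)%E then Ccost c (bpath q (fine t)) G + kappa%:E else 0))%E.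
Proof.
move=> qI t0 GB; rewrite vsh_itv// disc_ush//.
move: t t0 GB => [s||]// t0 GB; last first.
  rewrite /ed ltxx !mul0e !adde0 lee_fin subr0 mulr1 lerD2r.
  exact: vl_le_vstar.
rewrite /ed ltry /= in GB *; rewrite lee_fin in t0.
have {}GB := GB isT; rewrite (integral_vsh GB).
have := vstar_acquire qI t0 GB.
have bI : bpath q s \in `[0, 1] by exact: bpath_itv.
have C0 := Ccost_ge0 bI GB.
have [M hM] := vstar_bound.
have iv : G.-integrable I01 (EFin \o vstar).
  by apply: (@bounded_integrable _ _ _ _ _ _ M) => //; exact: measurable_vstar.
rewrite -(fineK (integrable_fin_num _ iv))//.
case: (Ccost c _ G) C0 => [C||]//=; last first.
  by move=> _ _; rewrite addye// gt0_muley ?lte_fin ?expR_gt0// addey// leey.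
rewrite -!(EFinM, EFinD) !lee_fin => C0.
rewrite ler_pdivlMr ?expR_gt0//; lra.
Qed.

(** Tonelli: the integrand, cut off at the duration, is jointly measurable in belief, duration and
    time, and nonnegative thanks to the shift; time is integrated out. *)
Lemma measurable_disc_ush :
  measurable_fun setT (fun x : R * \bar R => (disc ush x.1 x.2)%:E).
Proof.
pose f (z : (R * \bar R) * measurableTypeR R) : \bar R :=
  ((fun z : (R * \bar R) * measurableTypeR R =>
     (expR (- r * z.2) * ush (bpath z.1.1 z.2))%:E) \_
   [set z | (0 <= z.2) && (z.2%:E < z.1.2)%E]) z.
have -> : (fun x : R * \bar R => (disc ush x.1 x.2)%:E) =
    fubini_F (@lebesgue_measure R) f.
  apply/funext => x; rewrite -(integral_disc _ _ r_gt0 _ _ ush_continuous ush_bound).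
  rewrite integral_mkcond /fubini_F; apply: eq_integral => s _.
  rewrite /f /patch; congr (if _ then _ else _).
  by apply/idP/idP; rewrite !inE /before/=; [move=> [-> ->]|move=> /andP].
apply: measurable_fun_fubini_tonelli_F; last first.
  move=> z; rewrite /f /patch; case: ifPn => // _.
  by rewrite lee_fin mulr_ge0 ?expR_ge0 ?ush_ge0.
have mz2 : measurable_fun setT (fun z : (R * \bar R) * measurableTypeR R => z.2 : R).
  exact: measurable_snd.
have mz11 : measurable_fun setT (fun z : (R * \bar R) * measurableTypeR R => z.1.1 : R).
  exact: (measurableT_comp measurable_fst measurable_fst).
have mz12 : measurable_fun setT (fun z : (R * \bar R) * measurableTypeR R => z.1.2).
  exact: (measurableT_comp measurable_snd measurable_fst).
have me (k : R) : measurable_fun setT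
    (fun z : (R * \bar R) * measurableTypeR R => expR (k * z.2)).
  apply: measurableT_comp; first exact: measurable_expR.
  by apply: measurable_funM.
pose b (z : (R * \bar R) * measurableTypeR R) := (0 <= z.2) && (z.2%:E < z.1.2)%E.
apply: (@measurable_restrictT _ _ _ _ [set z | b z] _ _).1.
  have mb : measurable_fun setT b.
    apply: measurable_and.
      by apply: measurable_fun_ler.
    by apply: measurable_fun_lte => //; exact/measurable_EFinP.
  have := mb measurableT [set true] I; rewrite setTI.
  by congr measurable.
apply: measurable_funTS; apply/measurable_EFinP; apply: measurable_funM; first exact: me.
apply: measurableT_comp.
  exact: (continuous_measurable_fun ush_continuous).
rewrite /Defs.bpath; apply: measurable_funD; apply: measurable_funM => //.
by apply: measurable_funB => //.
Qed.

Section epochs.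
Context {d : measure_display} {Om : measurableType d}.
Variables (tau : nat -> Om -> \bar R) (Q : nat -> Om -> R)
  (F : nat -> Om -> probability R R) (p : R).

(** An epoch is indexed by the acquisition that ends it, so that flow and cost of the same index
    enter one application of [one_step]. The term [i] of the series in [flow] is therefore epoch
    [i.+1]. *)
Definition epoch_flow i w : R :=
  if i is k.+1 then ed (tau k w) * disc ush (Q k w) (tau k.+1 w - tau k w)
  else disc ush p (tau 0 w).

Definition epoch_cost i w : \bar R :=
  (if (tau i w < +oo)%E then (expR (- r * fine (tau i w)))%:E
     * (Ccost c (prior lam0 lam1 tau Q p i w) (F i w) + kappa%:E) else 0)%E.

Lemma epoch_flow_ge0 i w : 0 <= epoch_flow i w.
Proof.
case: i => [|i] /=; first exact: disc_ush_ge0.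
by rewrite mulr_ge0 ?ed_ge0// disc_ush_ge0.
Qed.

End epochs.

Section verification.
Context (d : measure_display) (Om : measurableType d).
Variables (P : probability Om R) (tau : nat -> Om -> \bar R) (Q : nat -> Om -> R)
  (F : nat -> Om -> probability R R) (p : R).
Hypothesis pI : p \in `[0, 1].
Hypothesis adm : admissible lam0 lam1 P tau Q F p.

Let mtau i : measurable_fun setT (tau i). Proof. by case: adm. Qed.
Let mQ i : measurable_fun setT (Q i). Proof. by case: adm => _ []. Qed.
Let tau0_ge0 w : (0 <= tau 0 w)%E. Proof. by case: adm => _ [_ []]. Qed.
Let tau_le i w : (tau i w <= tau i.+1 w)%E.
Proof. by case: adm => _ [_ [_ [H _]]]; case: (H i w). Qed.
Let tau_unbounded w (T : R) : exists i, (T%:E < tau i w)%E.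
Proof. by case: adm => _ [_ [_ [_ []]]]. Qed.
Let QI i w : Q i w \in `[0, 1].
Proof. by case: adm => _ [_ [_ [_ [_ [H _]]]]]; rewrite in_itv/=; exact: H. Qed.
Let FB i w : (tau i w < +oo)%E -> inB (prior lam0 lam1 tau Q p i w) (F i w).
Proof. by case: adm => _ [_ [_ [_ [_ [_ [H _]]]]]]; exact: H. Qed.
Let hist_F i (B : set R) : measurable B -> forall Y : set (\bar R), measurable Y ->
  history tau Q i ((fun w => F i w B) @^-1` Y).
Proof. by case: adm => _ [_ [_ [_ [_ [_ [_ [H _]]]]]]]; exact: H. Qed.
Let PF i (E : set Om) (B : set R) : history tau Q i E -> measurable B ->
  P (E `&` [set w | (tau i w < +oo)%E] `&` Q i @^-1` B) =
  (\int[P]_(w in E `&` [set w | (tau i w < +oo)%E]) F i w B)%E.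
Proof. by case: adm => _ [_ [_ [_ [_ [_ [_ [_ H]]]]]]]; exact: H. Qed.

Let tau_ge0 i w : (0 <= tau i w)%E.
Proof. by elim: i => // i /le_trans; apply. Qed.

Let history_measurable i : history tau Q i `<=` measurable.
Proof.
apply: smallest_sub; first exact: sigma_algebra_measurable.
by move=> E [[j [B [_ [mB ->]]]]|[j [B [_ [mB ->]]]]];
  rewrite -[X in measurable X]setTI; [exact: mtau|exact: mQ].
Qed.

Let mF i (B : set R) : measurable B -> measurable_fun setT (fun w => F i w B).
Proof.
by move=> mB _ Y mY; rewrite setTI; apply: history_measurable; exact: hist_F.
Qed.

(** Belief, discount factor and remaining wait at the start of epoch [i]. Once the policy has
    stopped, [gap] is an indeterminate difference, but [pre] is then 0. *)
Let bel i w := if i is k.+1 then Q k w else p.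
Let pre i w := if i is k.+1 then ed (tau k w) else 1.
Let gap i w := if i is k.+1 then (tau k.+1 w - tau k w)%E else tau 0 w.

Let belI i w : bel i w \in `[0, 1]. Proof. by case: i => [|i] /=. Qed.

Let pre_ge0 i w : 0 <= pre i w.
Proof. by case: i => [|i] /=; [exact: ler01|exact: ed_ge0]. Qed.

(* Either the policy has already stopped, or the [i]-th acquisition comes after
   a nonnegative waiting time [gap i w] started at the belief [bel i w]. *)
Let gap_cases i w :
  (pre i w = 0 /\ tau i w = +oo%E) \/
  [/\ (0 <= gap i w)%E, (tau i w < +oo)%E = (gap i w < +oo)%E,
      (tau i w < +oo)%E ->
        prior lam0 lam1 tau Q p i w = bpath (bel i w) (fine (gap i w)) &
      ed (tau i w) = pre i w * ed (gap i w)].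
Proof.
case: i => [|i] /=; first by right; split => //; rewrite mul1r.
have := tau_le i w; have := tau_ge0 i w.
case: (tau i w) => [s||]//; last first.
  by move=> _; rewrite leye_eq => /eqP ->; left; rewrite /ed ltxx.
case: (tau i.+1 w) => [s'||]// s0; last first.
  by move=> _; right; rewrite addye//= ltxx; split => //; rewrite /ed ltxx mulr0.
rewrite lee_fin => ss'; right; rewrite -EFinB; split => //.
- by rewrite lee_fin subr_ge0.
- by rewrite !ltry.
- by rewrite /ed !ltry /= -expRD -mulrDr addrC subrK.
Qed.

Local Notation flowp := (epoch_flow tau Q p).
Local Notation cost := (epoch_cost tau Q F p).

Let flowpE i w : flowp i w = pre i w * disc ush (bel i w) (gap i w).
Proof. by case: i => [|i] //=; rewrite mul1r. Qed.

Let flowp_ge0 i w : 0 <= flowp i w.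
Proof. exact: epoch_flow_ge0. Qed.

(** [Y i] is the discounted shifted value at the start of epoch [i]; [X i] is the flow of that epoch
    plus the discounted mean of the shifted value under the chosen distribution, gross of costs. *)
Let X i w : \bar R := ((flowp i w)%:E + (ed (tau i w))%:E * \int[F i w]_x vsh x)%E.
Let Y i w : \bar R := ((pre i w)%:E * vsh (bel i w))%E.

Let prior_itv i w : (tau i w < +oo)%E -> prior lam0 lam1 tau Q p i w \in `[0, 1].
Proof.
move=> tw; have [[_ ti]|[g0 _ -> // _]] := gap_cases i w; first by rewrite ti in tw.
by apply: bpath_itv => //; exact: fine_ge0.
Qed.

Lemma epoch_cost_ge0 i w : (0 <= cost i w)%E.
Proof.
rewrite /epoch_cost; case: ifPn => // tw; rewrite mule_ge0 ?lee_fin ?expR_ge0//.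
by rewrite adde_ge0 ?lee_fin ?(ltW kappa_gt0)//; apply: Ccost_ge0; [exact: prior_itv|exact: FB].
Qed.

Let vsh_int_ge0 i w : (0 <= \int[F i w]_x vsh x)%E.
Proof. by apply: integral_ge0 => x _; exact: ge0_measurable_vsh.2. Qed.

Let X_ge0 i w : (0 <= X i w)%E.
Proof. by rewrite adde_ge0 ?lee_fin// mule_ge0 ?lee_fin ?ed_ge0. Qed.

Let Y_ge0 i w : (0 <= Y i w)%E.
Proof. by rewrite mule_ge0 ?lee_fin// ge0_measurable_vsh.2. Qed.

Let Y_fin i w : Y i w \is a fin_num.
Proof. by rewrite /Y vsh_itv//. Qed.

Let X_le i w : (X i w <= Y i w + cost i w)%E.
Proof.
have [[pr0 ti]|[g0 tg priorE edE]] := gap_cases i w.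
  rewrite /X flowpE pr0 ti /ed ltxx mul0r !mul0e adde0 adde_ge0//.
  exact: epoch_cost_ge0.
have : ((gap i w < +oo)%E -> inB (bpath (bel i w) (fine (gap i w))) (F i w)).
  by rewrite -tg => tw; rewrite -priorE//; exact: FB.
move=> /(one_step (belI i w) g0).
move=> /(lee_wpmul2l (x := (pre i w)%:E)); rewrite lee_fin => /(_ (pre_ge0 i w)).
rewrite ge0_muleDr//; last 2 first.
- by rewrite lee_fin disc_ush_ge0.
- by rewrite mule_ge0 ?lee_fin ?ed_ge0.
rewrite muleA -!EFinM -edE -flowpE => /le_trans; apply.
rewrite ge0_muleDr//; last 2 first.
- exact: ge0_measurable_vsh.2.
- rewrite mule_ge0 ?lee_fin ?ed_ge0//; case: ifPn => // gw.
  rewrite adde_ge0 ?lee_fin ?(ltW kappa_gt0)//.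
  have tw : (tau i w < +oo)%E by rewrite tg.
  by rewrite -priorE//; apply: Ccost_ge0; [exact: prior_itv|exact: FB].
rewrite leeD2l// muleA -EFinM -edE /epoch_cost -tg.
by case: ifPn => tw; [rewrite /ed tw priorE|rewrite mule0].
Qed.

(* [epoch_cost] need not be measurable in [w]; [costL] is a measurable lower bound
   for it that is still large enough for the one-step inequality. *)
Let costL i w : \bar R := maxe 0%E (X i w - Y i w)%E.

Let costL_le i w : (costL i w <= cost i w)%E.
Proof. by rewrite ge_max epoch_cost_ge0/= leeBlDl// X_le. Qed.

Let costL_ge0 i w : (0 <= costL i w)%E.
Proof. by rewrite le_max lexx. Qed.

Let X_leL i w : (X i w <= Y i w + costL i w)%E.
Proof. by rewrite -leeBlDl// le_max lexx orbT. Qed.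

Let med i : measurable_fun setT (fun w => ed (tau i w)).
Proof. by apply: measurableT_comp => //; exact: measurable_ed. Qed.

Let mbel i : measurable_fun setT (bel i).
Proof. by case: i => [|i]; [exact: measurable_cst|exact: mQ]. Qed.

Let mpre i : measurable_fun setT (pre i).
Proof. by case: i => [|i]; [exact: measurable_cst|exact: med]. Qed.

Let mgap i : measurable_fun setT (gap i).
Proof. by case: i => [|i]; [exact: mtau|exact: emeasurable_funB]. Qed.

Let mflowp i : measurable_fun setT (fun w => (flowp i w)%:E).
Proof.
under eq_fun do rewrite flowpE EFinM.
apply: emeasurable_funM; first exact/measurable_EFinP.
exact: (@measurableT_comp _ _ _ _ _ _ (fun x => (disc ush x.1 x.2)%:E) setT
  (fun w => (bel i w, gap i w)) measurable_disc_ush (measurable_fun_pair (mbel i) (mgap i))).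
Qed.

Let mvshF i : measurable_fun setT (fun w => (ed (tau i w))%:E * \int[F i w]_x vsh x)%E.
Proof.
apply: emeasurable_funM; first exact/measurable_EFinP.
apply: (@measurable_fun_integral_kernel _ _ _ _ _ (fun w => F i w)).
- by move=> B mB; exact: mF.
- exact: ge0_measurable_vsh.2.
- exact: ge0_measurable_vsh.1.
Qed.

Let mX i : measurable_fun setT (X i). Proof. exact: emeasurable_funD. Qed.

Let mY i : measurable_fun setT (Y i).
Proof.
apply: emeasurable_funM; first exact/measurable_EFinP.
by apply: measurableT_comp => //; exact: ge0_measurable_vsh.1.
Qed.

Let mcostL i : measurable_fun setT (costL i).
Proof. by apply: measurable_maxe => //; exact: emeasurable_funB. Qed.

(** Given the history, [Q i] has law [F i], so averaging over [F i] may be replaced by evaluating at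
    [Q i]. This law is prescribed only where [tau i] is finite; elsewhere the discount factor
    vanishes. *)
Let expected_vsh i :
  (\int[P]_w ((ed (tau i w))%:E * \int[F i w]_x vsh x) = \int[P]_w Y i.+1 w)%E.
Proof.
pose D := [set w | (tau i w < +oo)%E].
have mD : measurable D.
  have mb : measurable_fun setT (fun w => tau i w < +oo)%E.
    by apply: measurable_fun_lte => //; exact: measurable_cst.
  by have := mb measurableT [set true] I; rewrite setTI; congr measurable.
have toD (h : Om -> \bar R) :
    (\int[P]_w ((ed (tau i w))%:E * h w) = \int[P]_(w in D) ((ed (tau i w))%:E * h w))%E.
  rewrite [RHS]integral_mkcond; apply: eq_integral => w _.
  rewrite /patch; case: ifPn => // /negP; rewrite inE /D/= => /negP tw.
  by rewrite /ed (negbTE tw) mul0e.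
rewrite toD /Y /= [RHS]toD; apply/esym.
apply: (@integral_average _ Om R P (history_gen tau Q i) D (Q i) (F i)) => //.
- exact: history_measurable.
- by move=> B mB; exact: mF.
- by move=> E B hE mB; exact: PF.
- move=> U mU; apply: sub_sigma_algebra; left.
  exists i, ((fun t => (ed t)%:E) @^-1` U); split => //; split => //.
  rewrite -[X in measurable X]setTI.
  by have /measurable_EFinP := measurable_ed; apply.
- by move=> w; rewrite lee_fin ed_ge0.
- exact: ge0_measurable_vsh.
- by exists (L + L) => x; exact: vsh_le.
Qed.

Let expected_partial n :
  (\sum_(i < n) \int[P]_w (flowp i w)%:E + \int[P]_w Y n w <=
   vsh p + \sum_(i < n) \int[P]_w costL i w)%E.
Proof.
elim: n => [|n IH].
  rewrite !big_ord0 add0e adde0 /Y /= mul1e.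
  by rewrite (integral_cst P measurableT) [X in (_ * X)%E]probability_setT mule1.
rewrite !big_ord_recr/=.
have step : (\int[P]_w (flowp n w)%:E + \int[P]_w Y n.+1 w <=
    \int[P]_w Y n w + \int[P]_w costL n w)%E.
  rewrite -expected_vsh -!ge0_integralD//.
  - apply: ge0_le_integral => //.
    + by move=> w _; exact: X_ge0.
    + exact: mX.
    + exact: emeasurable_funD.
    + by move=> w _; exact: X_leL.
  - by move=> w _; rewrite lee_fin.
  - by move=> w _; rewrite mule_ge0 ?lee_fin ?ed_ge0.
rewrite -addeA; apply: (le_trans (leeD2l _ step)).
rewrite addeA; apply: (le_trans (leeD2r _ IH)).
by rewrite -addeA.
Qed.

Let first_flow w :
  (\int[lebesgue_measure]_(t in [set t : R | (0 <= t)%R /\ (t%:E < tau 0 w)%E])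
     (expR (- r * t) * u (bpath p t))%:E)%E =
  (flowp 0 w - L * (1 - ed (tau 0 w)))%:E.
Proof.
rewrite integral_u_before// /= disc_ush//.
by congr EFin; ring.
Qed.

(** The shift accrued over an epoch is [L] times the drop of the discount factor, so these
    corrections telescope in [flow_epochs]. *)
Let later_flow i w :
  (\int[lebesgue_measure]_(t in [set t : R | (tau i w <= t%:E)%E /\
                                             (t%:E < tau i.+1 w)%E])
     (expR (- r * t) * u (bpath (Q i w) (t - fine (tau i w))))%:E)%E =
  (flowp i.+1 w - L * (ed (tau i w) - ed (tau i.+1 w)))%:E.
Proof.
have := gap_cases i.+1 w; rewrite flowpE /=.
have := tau_ge0 i w; case ti : (tau i w) => [s||]//= s0; last first.
  have -> : tau i.+1 w = +oo%E by apply/eqP; rewrite -leye_eq -ti.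
  rewrite (_ : [set t | _] = set0) ?integral_set0; last first.
    by apply/seteqP; split => t //= [+ _]; rewrite leye_eq.
  by move=> _; rewrite /ed ltxx; congr EFin; ring.
move=> [[]|[g0 _ _ edE]].
  by rewrite /ed ltry => /eqP; rewrite gt_eqF// expR_gt0.
have -> : [set t : R | (s%:E <= t%:E)%E /\ (t%:E < tau i.+1 w)%E] =
    [set t : R | (s%:E <= t%:E)%E /\ (t%:E < s%:E + (tau i.+1 w - s%:E))%E].
  by rewrite addeC subeK.
rewrite disc_ush// edE.
rewrite [RHS](_ : _ = (expR (- r * s) * disc uc (Q i w) (tau i.+1 w - s%:E))%:E).
  2: by congr EFin; rewrite /ed ltry /=; ring.
rewrite -(integral_disc_translation _ _ r_gt0 _ _ _ uc_continuous uc_K).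
apply: eq_integral => t; rewrite inE/= lee_fin => -[st _].
by rewrite /uc clamp_id// bpath_itv// subr_ge0.
Qed.

Let ed_tau_cvg w : (fun n => ed (tau n w)) @ \oo --> (0 : R).
Proof.
apply/cvgrPdist_lt => e e0.
have r0 := r_gt0.
(* Past this threshold [r * tau n w > e^-1], and [expR x >= 1 + x] puts the discount factor below
   [e]. *)
have [N hN] := tau_unbounded w (e^-1 / r).
exists N => // n /= Nn; rewrite sub0r normrN ger0_norm ?ed_ge0//.
have : ((e^-1 / r)%:E < tau n w)%E.
  apply: (lt_le_trans hN); elim: n Nn => [|n IH]; first by rewrite leqn0 => /eqP ->.
  by rewrite leq_eqVlt => /predU1P[->//|]; rewrite ltnS => /IH/le_trans; apply.
rewrite /ed; case: ifPn => // tn.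
have tf : tau n w \is a fin_num by rewrite ge0_fin_numE.
rewrite -(fineK tf) lte_fin ltr_pdivrMr// => h.
rewrite mulNr expRN -[e]invrK ltf_pV2 ?posrE ?invr_gt0 ?expR_gt0//.
by have := expR_ge1Dx (r * fine (tau n w)); rewrite mulrC in h *; lra.
Qed.

Lemma flow_epochs w : flow lam0 lam1 r ut tau Q p w =
  (\sum_(i <oo) (flowp i w)%:E - L%:E)%E.
Proof.
rewrite /flow first_flow; set a := flowp 0 w - _.
pose S := (\sum_(i <oo) (flowp i w)%:E)%E.
have cS : (fun n => \sum_(0 <= i < n) (flowp i w)%:E)%E @ \oo --> S.
  by apply: is_cvg_nneseries => n _ _; rewrite lee_fin.
have cE : (fun n => (L * (1 - ed (tau n w)) + a)%:E) @ \oo --> (L + a)%:E.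
  apply: cvg_EFin; first by apply: nearW.
  have -> : L + a = L * (1 - 0) + a by ring.
  apply: cvgD; last exact: cvg_cst.
  apply: cvgM; first exact: cvg_cst.
  by apply: cvgB; [exact: cvg_cst|exact: ed_tau_cvg].
(* These are the partial sums of the series in [flow]: [n] of its terms involve the first [n.+1]
   shifted epochs, less the first one and the telescoped corrections. *)
have c2 : (fun n => \sum_(0 <= i < n.+1) (flowp i w)%:E
    - (L * (1 - ed (tau n w)) + a)%:E)%E @ \oo --> (S - (L + a)%:E)%E.
  by apply: cvgeB => //; [exact: fin_num_adde_defl|rewrite (cvg_shiftS (fun n => \sum_(0 <= i < n) _)%E)].
rewrite (@cvg_lim _ _ _ _ _ _ (S - (L + a)%:E)%E)//.
  rewrite -/S; move: (S) => [z||]//; rewrite -!EFinB -EFinD; congr EFin; ring.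
apply: cvg_trans c2; apply: near_eq_cvg; apply: nearW => n.
elim: n => [|n IH].
  rewrite big_nat1 big_geq// -EFinB /a; congr EFin; ring.
rewrite [RHS]big_nat_recr//= -IH later_flow big_nat_recr//= sumEFin.
by rewrite -!(EFinB, EFinD); congr EFin; ring.
Qed.

Let integral_flow : (\int[P]_w flow lam0 lam1 r ut tau Q p w <=
  \sum_(i <oo) \int[P]_w (flowp i w)%:E - L%:E)%E.
Proof.
have sum_ge0 w : (0 <= \sum_(i <oo) (flowp i w)%:E)%E.
  by apply: nneseries_ge0 => i _ _; rewrite lee_fin.
have fge0 i w : setT w -> (0 <= (flowp i w)%:E)%E by rewrite lee_fin.
rewrite -(integral_nneseries P measurableT mflowp fge0).
set I := (\int[P]_w \sum_(i <oo) (flowp i w)%:E)%E.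
(* Only an upper bound is claimed, so an infinite total is harmless. *)
have [->|Ifin] := eqVneq I +oo%E; first by rewrite addye// leey.
have mS : measurable_fun setT (fun w => \sum_(i <oo) (flowp i w)%:E)%E.
  by apply: ge0_emeasurable_sum => // i w _ _; exact: fge0.
under eq_integral do rewrite flow_epochs.
rewrite integralB//; last 2 first.
- apply/integrableP; split => //; rewrite ltey.
  by under eq_integral do rewrite gee0_abs//.
- by apply: (@bounded_integrable _ _ _ _ _ (cst L) `|L|).
rewrite [X in (_ - X)%E](integral_cst P measurableT).
by rewrite [X in (_ - (_ * X))%E]probability_setT mule1.
Qed.

Let integral_costs : (\sum_(i <oo) \int[P]_w costL i w <=
  \int[P]_w costs lam0 lam1 r kappa c tau Q F p w)%E.
Proof.
rewrite -integral_nneseries//.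
apply: ge0_le_integral_any => w.
  by apply: nneseries_ge0.
by apply: lee_nneseries => // i _; exact: costL_le.
Qed.

Lemma payoff_le_vstar : (payoff lam0 lam1 r kappa ut c P tau Q F p <= (vstar p)%:E)%E.
Proof.
rewrite /payoff.
have fge0 i : (0 <= \int[P]_w (flowp i w)%:E)%E.
  by apply: integral_ge0 => w _; rewrite lee_fin.
have cge0 i : (0 <= \int[P]_w costL i w)%E by exact: integral_ge0.
have bound : (\sum_(i <oo) \int[P]_w (flowp i w)%:E <=
    (vstar p + L)%:E + \int[P]_w costs lam0 lam1 r kappa c tau Q F p w)%E.
  apply: lime_le; first by apply: is_cvg_nneseries.
  apply: nearW => n; rewrite big_mkord -vsh_itv//.
  apply: (@le_trans _ _ (vsh p + \sum_(i < n) \int[P]_w costL i w)%E).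
    apply: le_trans (expected_partial n); rewrite leeDl//.
    by apply: integral_ge0 => w _; exact: Y_ge0.
  rewrite leeD2l// (le_trans _ integral_costs)//.
  rewrite -(big_mkord xpredT (fun i => \int[P]_w costL i w)%E).
  exact: nneseries_lim_ge.
have := integral_flow.
move: bound; set J := (\int[P]_w costs _ _ _ _ _ _ _ _ _ w)%E.
have J0 : (0 <= J)%E.
  apply: integral_ge0 => w _; apply: nneseries_ge0 => i _ _; exact: epoch_cost_ge0.
(* If the expected cost is [+oo], the payoff is [-oo] whatever the flow integral, since adding [-oo]
   always yields [-oo]. *)
move: J J0 => [j||]// J0; last by rewrite addeNy leNye.
rewrite -EFinD => bound fl; rewrite leeBlDr//; apply: (le_trans fl).
by rewrite leeBlDr// (le_trans bound)// -!EFinD lee_fin; lra.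
Qed.

End verification.

(** * Gluing policies *)

Definition branch {T : Type} (f g : nat -> T) (w : nat) : T :=
  if odd w then g w./2 else f w./2.

Definition leaf (b : bool) (m : nat) : nat := (b + m.*2)%N.

Lemma branch_leaf T (f g : nat -> T) b m :
  branch f g (leaf b m) = if b then g m else f m.
Proof. by rewrite /branch /leaf oddD odd_double oddb addbF half_bit_double. Qed.

Lemma leaf_half w : w = leaf (odd w) w./2.
Proof. by rewrite /leaf odd_double_half. Qed.

Let mleaf b : measurable_fun [set: nat] (leaf b). Proof. by []. Qed.

HB.instance Definition _ b := isMeasurableFun.Build _ _ _ _ (leaf b) (mleaf b).

Section branching.
Variables (a : R) (Px Py : probability nat R).
Hypothesis aI : 0 <= a <= 1.

Definition branch_law : probability nat R :=
  mixture (distribution Px (leaf false)) (distribution Py (leaf true)) aI.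

Lemma branch_lawE E : branch_law E =
  ((1 - a)%:E * Px [set m | E (leaf false m)] + a%:E * Py [set m | E (leaf true m)])%E.
Proof. exact: mixtureE. Qed.

Lemma ge0_integral_branch_law (D : set nat) (f : nat -> \bar R) : (forall w, (0 <= f w)%E) ->
  (\int[branch_law]_(w in D) f w =
   (1 - a)%:E * \int[Px]_(m in [set m | D (leaf false m)]) f (leaf false m) +
   a%:E * \int[Py]_(m in [set m | D (leaf true m)]) f (leaf true m))%E.
Proof.
move=> f0; rewrite ge0_integral_mixture//.
by rewrite /distribution !ge0_integral_pushforward.
Qed.

Lemma Rintegral_branch_law (f : nat -> R) M : (forall w, `|f w| <= M) ->
  Rintegral branch_law setT f =
  (1 - a) * Rintegral Px setT (f \o leaf false) + a * Rintegral Py setT (f \o leaf true).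
Proof.
move=> fM; have fi (m : probability nat R) (g : nat -> nat) :
    m.-integrable setT (EFin \o (f \o g)).
  by apply: (@bounded_integrable _ _ _ _ _ _ M) => // x _; exact: fM.
rewrite /Rintegral integral_mixture//; try exact: (fi _ id).
rewrite !integral_distribution//; try exact: fi.
rewrite -[X in (_%:E * X + _)%E](fineK (integrable_fin_num _ (fi _ _)))//.
rewrite -[X in (_ + _%:E * X)%E](fineK (integrable_fin_num _ (fi _ _)))//.
Qed.

End branching.

(* The first acquisition is kept away from time [0] so that it can follow an
   acquisition of another policy. *)
Definition attains (p J : R) : Prop :=
  exists (P : probability nat R) (tau : nat -> nat -> \bar R) (Q : nat -> nat -> R)
    (F : nat -> nat -> probability R R) (fl co : nat -> R) (M : R),
  [/\ admissible lam0 lam1 P tau Q F p,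
      forall w, (0 < tau 0%N w)%E /\ (exists N, tau N w = +oo%E),
      forall w, flow lam0 lam1 r ut tau Q p w = (fl w)%:E /\
                costs lam0 lam1 r kappa c tau Q F p w = (co w)%:E,
      forall w, `|fl w| <= M /\ `|co w| <= M &
      J = Rintegral P setT fl - Rintegral P setT co].

Lemma attains_payoff p J : attains p J ->
  exists (P : probability nat R) tau Q F, admissible lam0 lam1 P tau Q F p /\
    J%:E = payoff lam0 lam1 r kappa ut c P tau Q F p.
Proof.
move=> [P [tau [Q [F [fl [co [M [adm _ fc fM ->]]]]]]]].
exists P, tau, Q, F; split => //.
have fi g : (forall w, `|g w| <= M) -> P.-integrable setT (EFin \o g).
  by move=> gM; apply: (@bounded_integrable _ _ _ _ _ _ M) => // x _; exact: gM.
rewrite /payoff.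
under [X in (_ = X - _)%E]eq_integral do rewrite (fc _).1.
under [X in (_ = _ - X)%E]eq_integral do rewrite (fc _).2.
rewrite EFinB /Rintegral !fineK//; apply: integrable_fin_num => //; apply: fi => w;
  by case: (fM w).
Qed.

Lemma attains_le_vstar p J : p \in `[0, 1] -> attains p J -> J <= vstar p.
Proof.
move=> pI /attains_payoff[P [tau [Q [F [adm JE]]]]].
by rewrite -lee_fin JE; exact: payoff_le_vstar.
Qed.

Lemma attains_vl p : p \in `[0, 1] -> attains p (vl p).
Proof.
move=> pI.
exists (\d_ 0%N : probability nat R), (fun _ _ => +oo%E), (fun _ _ => 0),
  (fun _ _ => (\d_ (0 : R) : probability R R)), (fun=> vl p), (fun=> 0), `|vl p|; split.
- split; first by []. split; first by []. split; first by []. split; first by move=> i w; rewrite ltxx.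
  split; first by move=> w T; exists 0%N; rewrite ltry.
  split; first by move=> i w; rewrite lexx ler01.
  split; first by move=> i w; rewrite ltxx.
  split.
    move=> i B mB Y mY; set S := (X in history _ _ _ X).
    have [->|->] : S = setT \/ S = set0.
      have [h|h] := pselect (Y ((\d_ (0 : R) : probability R R) B)).
        by left; apply/seteqP; split.
      by right; apply/seteqP; split.
    + exact: (@measurableT _ (g_sigma_algebraType (history_gen _ _ i))).
    + exact: (@measurable0 _ (g_sigma_algebraType (history_gen _ _ i))).
  move=> i E B _ mB.
  have -> : [set w : nat | ((+oo : \bar R) < +oo)%E] = set0.
    by apply/seteqP; split => w //=; rewrite ltxx.
  by rewrite setI0 set0I measure0 integral_set0.
- by move=> w; split; [rewrite ltry|exists 0%N].
- move=> w; split.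
    rewrite /flow integral_u_before//.
    rewrite eseries0 ?adde0// => i _ _.
    rewrite (_ : [set t | _] = set0) ?integral_set0//.
    by apply/seteqP; split => t //= [+ _]; rewrite leye_eq.
  by rewrite /costs eseries0// => i _ _; rewrite ltxx.
- by move=> w; rewrite normr0 lexx.
- rewrite !Rintegral_cst// [X in fine X]probability_setT /=.
  by rewrite mulr1 mul0r subr0.
Qed.

Section concatenation.
Variables s x y p : R.
Hypothesis pI : p \in `[0, 1].
Hypothesis feas : feasible s x y p.
Let q := bpath p s.

Let s_gt0 : 0 < s. Proof. by case: feas. Qed.
Let Dx : fin_cost x. Proof. by case: feas. Qed.
Let Dy : fin_cost y. Proof. by case: feas. Qed.
Let xqy : x < q < y. Proof. by case: feas. Qed.

Variables (Px : probability nat R) (taux : nat -> nat -> \bar R) (Qx : nat -> nat -> R)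
  (Fx : nat -> nat -> probability R R).
Variables (Py : probability nat R) (tauy : nat -> nat -> \bar R) (Qy : nat -> nat -> R)
  (Fy : nat -> nat -> probability R R).
Hypothesis admx : admissible lam0 lam1 Px taux Qx Fx x.
Hypothesis admy : admissible lam0 lam1 Py tauy Qy Fy y.
Hypothesis taux_gt0 : forall w, (0 < taux 0 w)%E /\ (exists N, taux N w = +oo%E).
Hypothesis tauy_gt0 : forall w, (0 < tauy 0 w)%E /\ (exists N, tauy N w = +oo%E).

(** Acquisition 0 is the new lottery, whose outcome is the parity of the sample; acquisition [i.+1]
    is acquisition [i] of the branch selected by that parity, delayed by [s]. *)
Let tau i w : \bar R :=
  if i is k.+1 then (s%:E + branch (taux k) (tauy k) w)%E else s%:E.
Let Q i w : R := if i is k.+1 then branch (Qx k) (Qy k) w else branch (fun=> x) (fun=> y) w.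
Let F i w : probability R R :=
  if i is k.+1 then branch (Fx k) (Fy k) w else lottery xqy.
Let P : probability nat R := branch_law Px Py (lottery_weight_itv xqy).

Let taub b := if b then tauy else taux.
Let Qb b := if b then Qy else Qx.
Let Fb b := if b then Fy else Fx.
Let Pb b := if b then Py else Px.
Let zb b := if b then y else x.

Let admb b : admissible lam0 lam1 (Pb b) (taub b) (Qb b) (Fb b) (zb b).
Proof. by case: b. Qed.

Let taub_gt0 b w : (0 < taub b 0 w)%E /\ (exists N, taub b N w = +oo%E).
Proof. by case: b. Qed.

Let tau_leaf i b m : tau i.+1 (leaf b m) = (s%:E + taub b i m)%E.
Proof. by rewrite /tau branch_leaf; case: b. Qed.

Let Q_leaf i b m : Q i.+1 (leaf b m) = Qb b i m.
Proof. by rewrite /Q branch_leaf; case: b. Qed.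

Let Q0_leaf b m : Q 0 (leaf b m) = zb b.
Proof. by rewrite /Q branch_leaf; case: b. Qed.

Let F_leaf i b m : F i.+1 (leaf b m) = Fb b i m.
Proof. by rewrite /F branch_leaf; case: b. Qed.

Let leafP (S : nat -> Prop) : (forall b m, S (leaf b m)) -> forall w, S w.
Proof. by move=> h w; rewrite (leaf_half w). Qed.

Let taub_le b i m : (taub b i m <= taub b i.+1 m)%E.
Proof. by case: (admb b) => _ [_ [_ [H _]]]; case: (H i m). Qed.

Let taub_ge0 b i m : (0 <= taub b i m)%E.
Proof.
elim: i => [|i IH]; last exact: le_trans IH (taub_le b i m).
by case: (admb b) => _ [_ [H _]]; exact: H.
Qed.

Let tau_lty i b m : (s%:E + taub b i m < +oo)%E = (taub b i m < +oo)%E.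
Proof. by have := taub_ge0 b i m; case: (taub b i m) => [t||]// _; rewrite -EFinD !ltry. Qed.

Let prior_leaf i b m : (taub b i m < +oo)%E ->
  prior lam0 lam1 tau Q p i.+1 (leaf b m) = prior lam0 lam1 (taub b) (Qb b) (zb b) i m.
Proof.
move=> tm; have tf j : (j <= i)%N -> taub b j m \is a fin_num.
  move=> ji; rewrite ge0_fin_numE//; apply: le_lt_trans tm.
  elim: i ji => [|k IH]; first by rewrite leqn0 => /eqP ->.
  by rewrite leq_eqVlt => /predU1P[->//|]; rewrite ltnS => /IH/le_trans; apply.
rewrite /prior tau_leaf; case: i tm tf => [|i] tm tf.
  by rewrite Q0_leaf /= fineD// ?tf//= addrAC subrr add0r.
rewrite Q_leaf tau_leaf !fineD// ?tf//=.
by congr (bpath _ _); ring.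
Qed.

(** The parity of the sample is observable, because [Q 0] takes the distinct values [x] and [y] on
    the two branches; past times and posteriors of a branch can then be read off the glued
    policy. *)
Let history_up i b (E : set nat) : history (taub b) (Qb b) i E ->
  history tau Q i.+1 [set w | odd w = b /\ E w./2].
Proof.
pose T' := g_sigma_algebraType (history_gen tau Q i.+1).
have mb : measurable ([set w | odd w = b] : set T').
  apply: sub_sigma_algebra; right; exists 0%N, [set zb b]; split => //; split => //.
  apply/seteqP; split => w /=; rewrite /branch.
    by case: (odd w) => <-.
  have /andP[xq qy] := xqy; have xy := lt_trans xq qy; rewrite /zb.
  by case: (odd w); case: b => //= e; move: xy; rewrite e ltxx.
(* The events whose lift is observable form a sigma-algebra containing the generators; complements
   are taken inside the parity class. *)
have sub : <<s history_gen (taub b) (Qb b) i >> `<=`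
    [set E | measurable ([set w | odd w = b /\ E w./2] : set T')].
  apply: smallest_sub.
    split.
    - rewrite /=; have -> : [set w | odd w = b /\ set0 w./2] = set0.
        by apply/seteqP; split => w //= [].
      exact: (@measurable0 _ T').
    - move=> D mD /=; rewrite (_ : [set w | _] =
          [set w | odd w = b] `\` [set w | odd w = b /\ D w./2]).
        exact: measurableD.
      apply/seteqP; split => w /=; first by move=> [? [_ ?]]; split => // -[].
      by move=> [? h]; split => //; split => // ?; apply: h.
    - move=> D mD /=; rewrite (_ : [set w | _] =
          \bigcup_n [set w | odd w = b /\ D n w./2]).
        by apply: (@bigcupT_measurable _ T') => n; exact: mD.
      apply/seteqP; split => w /=; first by move=> [? [n _ ?]]; exists n.
      by move=> [n _ [? ?]]; split => //; exists n.
  move=> _ [[j [B [ji [mB ->]]]]|[j [B [ji [mB ->]]]]] /=.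
  - rewrite (_ : [set w | _] = [set w | odd w = b] `&`
        tau j.+1 @^-1` ((fun t => t - s%:E)%E @^-1` B)).
      apply: measurableI => //; apply: sub_sigma_algebra; left.
      exists j.+1, ((fun t => t - s%:E)%E @^-1` B); split => //; split => //.
      rewrite -[X in measurable X]setTI.
      by apply: emeasurable_funB => //; exact: measurable_id.
    have eq w : odd w = b -> (tau j.+1 w - s%:E)%E = taub b j w./2.
      by move=> ob; rewrite {1}(leaf_half w) ob tau_leaf addeAC subee// add0e.
    by apply/seteqP; split => w /= [ob] h; split => //; move: h; rewrite eq.
  - rewrite (_ : [set w | _] = [set w | odd w = b] `&` Q j.+1 @^-1` B).
      apply: measurableI => //; apply: sub_sigma_algebra; right.
      by exists j.+1, B.
    have eq w : odd w = b -> Q j.+1 w = Qb b j w./2.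
      by move=> ob; rewrite {1}(leaf_half w) ob Q_leaf.
    by apply/seteqP; split => w [ob h]; split => //; move: h;
      rewrite -[(_ @^-1` _) w]/(B (Q j.+1 w)) eq.
by move=> hE; exact: sub hE.
Qed.

(** Converse transfer: on a fixed branch [tau 0] and [Q 0] are constant, so they add nothing to the
    history of that branch. *)
Let history_down i b (E : set nat) : history tau Q i.+1 E ->
  history (taub b) (Qb b) i [set m | E (leaf b m)].
Proof.
pose T' := g_sigma_algebraType (history_gen (taub b) (Qb b) i).
have mcst (S : Prop) : measurable ([set _ | S] : set T').
  have [h|h] := pselect S.
    by rewrite (_ : [set _ | _] = setT)//; apply/seteqP; split.
  by rewrite (_ : [set _ | _] = set0)//; apply/seteqP; split.
have sub : <<s history_gen tau Q i.+1 >> `<=`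
    [set E | measurable ([set m | E (leaf b m)] : set T')].
  apply: smallest_sub.
    split.
    - exact: (mcst False).
    - move=> D mD /=; rewrite (_ : [set m | _] = ~` [set m | D (leaf b m)]).
        exact: measurableC.
      by apply/seteqP; split => m /=; [move=> []|move=> h; split].
    - move=> D mD /=; rewrite (_ : [set m | _] = \bigcup_n [set m | D n (leaf b m)])//.
      by apply: (@bigcupT_measurable _ T') => n; exact: mD.
  move=> _ [[j [B [ji [mB ->]]]]|[j [B [ji [mB ->]]]]] /=.
  - case: j ji => [|j] ji; first exact: (mcst (B s%:E)).
    rewrite (_ : [set m | _] = taub b j @^-1` ((fun t => s%:E + t)%E @^-1` B)).
      apply: sub_sigma_algebra; left.
      exists j, ((fun t => s%:E + t)%E @^-1` B); split => //; split => //.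
      rewrite -[X in measurable X]setTI.
      by apply: emeasurable_funD => //; exact: measurable_id.
    by apply/seteqP; split => m /=; rewrite branch_leaf; case: (b).
  - case: j ji => [|j] ji.
      rewrite (_ : [set m | _] = [set _ | B (zb b)]); first exact: (mcst (B (zb b))).
      by apply/seteqP; split => m /=; rewrite branch_leaf; case: (b).
    rewrite (_ : [set m | _] = Qb b j @^-1` B).
      by apply: sub_sigma_algebra; right; exists j, B.
    by apply/seteqP; split => m /=; rewrite branch_leaf; case: (b).
by move=> hE; exact: sub hE.
Qed.

(** The first acquisition time is the constant [s], so nothing is learned before the first draw. *)
Let history0 (E : set nat) : history tau Q 0 E -> E = set0 \/ E = setT.
Proof.
have sub : <<s history_gen tau Q 0 >> `<=` [set E | E = set0 \/ E = setT].
  apply: smallest_sub.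
    split; first by left.
    - by move=> D [->|->]; [right; rewrite setD0|left; rewrite setDv].
    - move=> D hD; have [h|h] := pselect (exists n, D n = setT).
        right; apply/seteqP; split => // w _; case: h => n hn; exists n => //.
        by rewrite hn.
      left; apply/seteqP; split => // w [n _]; have [->//|hn] := hD n.
      by exfalso; apply: h; exists n.
  move=> _ [[j [B [ji [mB ->]]]]|[j [B [ji _]]]]//.
  move: ji; rewrite leqn0 => /eqP ->.
  have [h|h] := pselect (B s%:E); [right|left]; by apply/seteqP; split.
by move=> hE; exact: sub hE.
Qed.

Lemma concat_admissible : admissible lam0 lam1 P tau Q F p.
Proof.
have s0 := s_gt0.
split; first by []. split; first by [].
split; first by move=> w; rewrite lee_fin ltW.
split.
  move=> [|i]; apply: leafP => b m; rewrite ?tau_leaf.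
    have [t0 _] := taub_gt0 b m; rewrite /tau -/tau.
    by split => [|_]; [rewrite leeDl// ltW|rewrite lteDl].
  have [le lt] : (taub b i m <= taub b i.+1 m)%E /\
    ((taub b i m < +oo)%E -> (taub b i m < taub b i.+1 m)%E).
    by case: (admb b) => _ [_ [_ [H _]]]; exact: H.
  by split => [|]; [rewrite leeD2l|rewrite tau_lty => /lt; rewrite lteD2lE].
split.
  apply: leafP => b m T; have [_ [N hN]] := taub_gt0 b m.
  by exists N.+1; rewrite tau_leaf hN addey// ltry.
split.
  move=> [|i]; apply: leafP => b m.
    rewrite Q0_leaf; case: (b); [have := Dy.1|have := Dx.1]; by rewrite in_itv.
  by rewrite Q_leaf; case: (admb b) => _ [_ [_ [_ [_ [H _]]]]]; exact: H.
split.
  move=> [|i]; apply: leafP => b m.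
    by move=> _; apply: inB_lottery; [exact: Dx.1|exact: Dy.1].
  rewrite tau_leaf tau_lty => tm; rewrite prior_leaf// F_leaf.
  by case: (admb b) => _ [_ [_ [_ [_ [_ [H _]]]]]]; exact: H.
split.
  move=> [|i] B mB Y mY.
    set S := (X in history _ _ _ X).
    have [->|->] : S = setT \/ S = set0.
      have [h|h] := pselect (Y (lottery xqy B)).
        by left; apply/seteqP; split.
      by right; apply/seteqP; split.
    + exact: (@measurableT _ (g_sigma_algebraType (history_gen tau Q 0))).
    + exact: (@measurable0 _ (g_sigma_algebraType (history_gen tau Q 0))).
  (* Each branch is treated inside its parity class, and the two classes are then united. *)
  have hb b : history tau Q i.+1 [set w | odd w = b /\ Y (Fb b i w./2 B)].
    apply: (@history_up i b [set m | Y (Fb b i m B)]).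
    by case: (admb b) => _ [_ [_ [_ [_ [_ [_ [H _]]]]]]]; exact: H.
  have := @measurableU _ (g_sigma_algebraType (history_gen tau Q i.+1)) _ _
    (hb true) (hb false).
  congr (history tau Q i.+1 _); apply/seteqP; split => w /=.
    by move=> [[ow]|[ow]]; rewrite /branch ow.
  by rewrite /branch; case: (odd w) => h; [left|right].
move=> [|i] E B hE mB.
  have -> : [set w | (tau 0 w < +oo)%E] = setT.
    by apply/seteqP; split => w //= _; exact: ltry.
  rewrite !setIT; have [->|->] := history0 hE.
    by rewrite set0I measure0 integral_set0.
  transitivity (lottery xqy B); last first.
    rewrite [RHS](integral_cst P measurableT (lottery xqy B)).
    by rewrite [X in (_ * X)%E]probability_setT mule1.
  rewrite setTI branch_lawE lotteryE.
  (* On a branch the first posterior is deterministic: its law is a point mass, written here as an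
     indicator evaluated at an arbitrary point. *)
  have Pcst b (S : Prop) : Pb b [set m | S] = (\1_[set _ : R | S] (0 : R))%:E.
    rewrite indicE; have [h|h] := pselect S.
      rewrite mem_set// (_ : [set m | S] = setT) ?probability_setT//.
      by apply/seteqP; split.
    rewrite memNset// (_ : [set m | S] = set0) ?measure0//.
    by apply/seteqP; split.
  congr (_ * _ + _ * _)%E.
    transitivity (Px [set _ | B x]).
      by congr (Px _); apply/seteqP; split => m /=; rewrite branch_leaf.
    by rewrite (Pcst false) diracE indicE.
  transitivity (Py [set _ | B y]).
    by congr (Py _); apply/seteqP; split => m /=; rewrite branch_leaf.
  by rewrite (Pcst true) diracE indicE.
have PFb b : Pb b [set m | (E `&` [set w | (tau i.+1 w < +oo)%E] `&` Q i.+1 @^-1` B)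
      (leaf b m)] =
    (\int[Pb b]_(m in [set m | (E `&` [set w | (tau i.+1 w < +oo)%E]) (leaf b m)])
       F i.+1 (leaf b m) B)%E.
  case: (admb b) => _ [_ [_ [_ [_ [_ [_ [_ H]]]]]]].
  have := H i _ B (@history_down i b E hE) mB.
  have eqD : [set m | E (leaf b m)] `&` [set m | (taub b i m < +oo)%E] =
      [set m | (E `&` [set w | (tau i.+1 w < +oo)%E]) (leaf b m)].
    by apply/seteqP; split => m [h1 h2]; split => //; move: h2; rewrite /= -/(tau i.+1 _) tau_leaf tau_lty.
  rewrite eqD => H'; transitivity (Pb b ([set m | (E `&` [set w | (tau i.+1 w < +oo)%E])
      (leaf b m)] `&` Qb b i @^-1` B)).
    by congr (Pb b _); apply/seteqP; split => m [h1 h2]; split => //; move: h2;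
      rewrite /= -/(Q i.+1 _) Q_leaf.
  by rewrite H'; apply: eq_integral => m _; rewrite F_leaf.
rewrite branch_lawE (PFb false) (PFb true) ge0_integral_branch_law//.
Qed.

Let zbI b : zb b \in `[0, 1].
Proof. by case: b; [exact: Dy.1|exact: Dx.1]. Qed.

Let edD t : (0 <= t)%E -> ed (s%:E + t) = expR (- r * s) * ed t.
Proof.
case: t => [t||]// _; last by rewrite addey// /ed ltxx mulr0.
by rewrite /ed -EFinD !ltry /= mulrDr expRD.
Qed.

Let series_cons (f : nat -> \bar R) : (forall i, (0 <= f i)%E) ->
  (\sum_(i <oo) f i = f 0%N + \sum_(i <oo) f i.+1)%E.
Proof.
move=> f0; rewrite nneseries_recl// -(nneseries_addn 1 f0).
by congr (_ + _)%E; apply: eq_eseriesr => i _; rewrite addn1.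
Qed.

Let epoch_flow_leaf i b m : epoch_flow tau Q p i.+1 (leaf b m) =
  expR (- r * s) * epoch_flow (taub b) (Qb b) (zb b) i m.
Proof.
case: i => [|i].
  rewrite /epoch_flow tau_leaf Q0_leaf.
  have -> : tau 0 (leaf b m) = s%:E by [].
  by rewrite {1}/ed ltry addeAC subee// add0e.
rewrite /epoch_flow !tau_leaf Q_leaf edD// -mulrA; congr (_ * _).
have := taub_le b i m; have := taub_ge0 b i m.
case: (taub b i m) => [t||]//; last by rewrite /ed ltxx !mul0r.
case: (taub b i.+1 m) => [t'||]// _ _.
by rewrite -!EFinD; congr (_ * disc _ _ _%:E); ring.
Qed.

(** Both flows are rewritten as series of nonnegative epochs, where the recursion holds term by
    term; the constants introduced by the shift cancel. *)
Lemma flow_leaf b m : flow lam0 lam1 r ut tau Q p (leaf b m) =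
  ((disc uc p s%:E)%:E +
   (expR (- r * s))%:E * flow lam0 lam1 r ut (taub b) (Qb b) (zb b) m)%E.
Proof.
have s0 := s_gt0.
have ef0 i : (0 <= (epoch_flow (taub b) (Qb b) (zb b) i m)%:E)%E.
  by rewrite lee_fin epoch_flow_ge0.
rewrite (flow_epochs pI concat_admissible) (flow_epochs (zbI b) (admb b)).
rewrite series_cons; last by move=> i; rewrite lee_fin epoch_flow_ge0.
under eq_eseriesr do rewrite epoch_flow_leaf EFinM.
rewrite nneseriesZl//.
have -> : epoch_flow tau Q p 0 (leaf b m) = disc uc p s%:E + L * (1 - expR (- r * s)).
  by rewrite /= disc_ush ?lee_fin ?ltW// /ed ltry.
have := @nneseries_ge0 _ _ xpredT 0 (fun i _ _ => ef0 i).
move: (\sum_(0 <= i <oo) _)%E => [z||]// _.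
  by rewrite -!EFinB -!(EFinM, EFinD, EFinB); congr EFin; ring.
by rewrite addye// !gt0_muley ?lte_fin ?expR_gt0// !addey// addye.
Qed.

Let epoch_cost_leaf i b m : epoch_cost tau Q F p i.+1 (leaf b m) =
  ((expR (- r * s))%:E * epoch_cost (taub b) (Qb b) (Fb b) (zb b) i m)%E.
Proof.
rewrite /epoch_cost tau_leaf tau_lty; case: ifPn => tm; last by rewrite mule0.
rewrite prior_leaf// F_leaf fineD// ?ge0_fin_numE//=.
by rewrite mulrDr expRD EFinM muleA.
Qed.

Lemma costs_leaf b m : costs lam0 lam1 r kappa c tau Q F p (leaf b m) =
  ((expR (- r * s) * (((y - q) * cf x + (q - x) * cf y) / (y - x) - cf q + kappa))%:E +
   (expR (- r * s))%:E * costs lam0 lam1 r kappa c (taub b) (Qb b) (Fb b) (zb b) m)%E.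
Proof.
have s0 := s_gt0.
have ec0 i := epoch_cost_ge0 (zbI b) (admb b) i m.
rewrite /costs -/(epoch_cost _ _ _ _).
transitivity (\sum_(i <oo) epoch_cost tau Q F p i (leaf b m))%E; first by [].
rewrite series_cons; last by move=> i; exact: (epoch_cost_ge0 pI concat_admissible).
under eq_eseriesr do rewrite epoch_cost_leaf.
rewrite nneseriesZl//; congr (_ + _)%E.
by rewrite /epoch_cost /= ltry Ccost_lottery// -EFinD -EFinM.
Qed.

Variables (flx cox fly coy : nat -> R) (Mx My : R).
Hypothesis fcx : forall w, flow lam0 lam1 r ut taux Qx x w = (flx w)%:E /\
  costs lam0 lam1 r kappa c taux Qx Fx x w = (cox w)%:E.
Hypothesis fcy : forall w, flow lam0 lam1 r ut tauy Qy y w = (fly w)%:E /\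
  costs lam0 lam1 r kappa c tauy Qy Fy y w = (coy w)%:E.
Hypothesis bx : forall w, `|flx w| <= Mx /\ `|cox w| <= Mx.
Hypothesis by_ : forall w, `|fly w| <= My /\ `|coy w| <= My.

Lemma attains_concat : attains p (binary_payoff s x y p
  (Rintegral Px setT flx - Rintegral Px setT cox)
  (Rintegral Py setT fly - Rintegral Py setT coy)).
Proof.
have s0 := s_gt0; have /andP[xq qy] := xqy.
have yx : 0 < y - x by lra.
pose C := ((y - q) * cf x + (q - x) * cf y) / (y - x) - cf q.
pose e := expR (- r * s).
pose flb b := if b then fly else flx.
pose cob b := if b then coy else cox.
have fcb b w : flow lam0 lam1 r ut (taub b) (Qb b) (zb b) w = (flb b w)%:E /\
  costs lam0 lam1 r kappa c (taub b) (Qb b) (Fb b) (zb b) w = (cob b w)%:E.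
  by case: b; [exact: fcy|exact: fcx].
pose M := `|Mx| + `|My|.
have bb b w : `|flb b w| <= M /\ `|cob b w| <= M.
  have := ler_norm Mx; have := ler_norm My; have := normr_ge0 Mx; have := normr_ge0 My.
  by rewrite /M; case: b; [case: (by_ w)|case: (bx w)] => *; split; lra.
pose fl := branch (fun m => disc uc p s%:E + e * flx m) (fun m => disc uc p s%:E + e * fly m).
pose co := branch (fun m => e * (C + kappa) + e * cox m) (fun m => e * (C + kappa) + e * coy m).
have flE b m : fl (leaf b m) = disc uc p s%:E + e * flb b m.
  by rewrite /fl branch_leaf; case: (b).
have coE b m : co (leaf b m) = e * (C + kappa) + e * cob b m.
  by rewrite /co branch_leaf; case: (b).
pose M' := `|disc uc p s%:E| + `|e * (C + kappa)| + `|e| * M.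
have bnd w : `|fl w| <= M' /\ `|co w| <= M'.
  elim/leafP: w => b m; rewrite flE coE; have [h1 h2] := bb b m.
  have e1 : `|e * flb b m| <= `|e| * M by rewrite normrM ler_wpM2l.
  have e2 : `|e * cob b m| <= `|e| * M by rewrite normrM ler_wpM2l.
  have := normr_ge0 (disc uc p s%:E); have := normr_ge0 (e * (C + kappa)).
  have := ler_normD (disc uc p s%:E) (e * flb b m).
  have := ler_normD (e * (C + kappa)) (e * cob b m).
  by rewrite /M' => *; split; lra.
exists P, tau, Q, F, fl, co, M'; split => //.
- exact: concat_admissible.
- apply: leafP => b m; split; first by rewrite /tau lte_fin.
  have [_ [N hN]] := taub_gt0 b m.
  by exists N.+1; rewrite tau_leaf hN addey.
- apply: leafP => b m; have [h1 h2] := fcb b m.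
  rewrite flow_leaf costs_leaf h1 h2 flE coE.
  by rewrite -!EFinM -!EFinD.
have Rint (m : probability nat R) (k l N : R) (g : nat -> R) : (forall w, `|g w| <= N) ->
    Rintegral m setT (fun w => k + l * g w) = k + l * Rintegral m setT g.
  move=> gN; have gi : m.-integrable setT (EFin \o g).
    by apply: (@bounded_integrable _ _ _ _ _ _ N).
  rewrite RintegralD//; last 2 first.
  - by apply: (@bounded_integrable _ _ _ _ _ (cst k) `|k|).
  - exact: integrable_EFinZl.
  by rewrite RintegralZl// Rintegral_cst// [X in fine X]probability_setT mulr1.
rewrite (Rintegral_branch_law _ _ _ (fun w => (bnd w).1)).
rewrite (Rintegral_branch_law _ _ _ (fun w => (bnd w).2)).
have -> : fl \o leaf false = (fun m => disc uc p s%:E + e * flx m).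
  by apply/funext => m; exact: (flE false).
have -> : fl \o leaf true = (fun m => disc uc p s%:E + e * fly m).
  by apply/funext => m; exact: (flE true).
have -> : co \o leaf false = (fun m => e * (C + kappa) + e * cox m).
  by apply/funext => m; exact: (coE false).
have -> : co \o leaf true = (fun m => e * (C + kappa) + e * coy m).
  by apply/funext => m; exact: (coE true).
rewrite (Rint _ _ _ _ _ (fun w => (bb false w).1)) (Rint _ _ _ _ _ (fun w => (bb true w).1)).
rewrite (Rint _ _ _ _ _ (fun w => (bb false w).2)) (Rint _ _ _ _ _ (fun w => (bb true w).2)).
rewrite /binary_payoff /gain -/q -/e /C /=.
by field; rewrite gt_eqF.
Qed.

End concatenation.

Lemma attains_binary s x y p Jx Jy : p \in `[0, 1] -> feasible s x y p ->
  attains x Jx -> attains y Jy -> attains p (binary_payoff s x y p Jx Jy).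
Proof.
move=> pI feas [Px [taux [Qx [Fx [flx [cox [Mx [admx tx fcx bx ->]]]]]]]].
move=> [Py [tauy [Qy [Fy [fly [coy [My [admy ty fcy by_ ->]]]]]]]].
exact: (attains_concat pI feas admx admy tx ty fcx fcy bx by_).
Qed.

(** * Lower bound on the value by simple policies *)

Definition simple_value p := sup [set J | attains p J].

Lemma has_sup_attains p : p \in `[0, 1] -> has_sup [set J | attains p J].
Proof.
move=> pI; split; first by exists (vl p); exact: attains_vl.
by exists (vstar p) => J; exact: attains_le_vstar.
Qed.

(** The lottery weights sum to 1, so an error common to both continuations is only discounted and
    does not grow through gluing. *)
Lemma binary_payoffD s x y p zx zy d : x < bpath p s < y ->
  binary_payoff s x y p (zx + d) (zy + d) =
  binary_payoff s x y p zx zy + expR (- r * s) * d.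
Proof.
move=> /andP[xq qy]; have yx : 0 < y - x by lra.
by rewrite /binary_payoff /gain; field; rewrite gt_eqF.
Qed.

Lemma superharmonic_simple_value : superharmonic simple_value.
Proof.
split => [p pI|p s x y pI feas].
  by apply: ub_le_sup; [case: (has_sup_attains pI)|exact: attains_vl].
have [s0 Dx Dy xy] := feas.
apply/ler_addgt0Pl => e e0.
have [Jx aJx hx] := sup_adherent e0 (has_sup_attains Dx.1).
have [Jy aJy hy] := sup_adherent e0 (has_sup_attains Dy.1).
have : binary_payoff s x y p (simple_value x) (simple_value y) <=
    binary_payoff s x y p (Jx + e) (Jy + e).
  by apply: le_binary_payoff => //; rewrite -lerBlDr ltW.
move=> /le_trans; apply; rewrite binary_payoffD// addrC lerD//.
  rewrite ger_pMl// -expR0 ler_expR mulNr oppr_le0 mulr_ge0 ?ltW//.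
apply: ub_le_sup; first by case: (has_sup_attains pI).
exact: attains_binary.
Qed.

Lemma vstar_le_value p : p \in `[0, 1] ->
  ((vstar p)%:E <= value lam0 lam1 r kappa ut c p)%E.
Proof.
move=> pI; apply: (@le_trans _ _ (simple_value p)%:E).
  by rewrite lee_fin; apply: vstar_le => //; exact: superharmonic_simple_value.
apply/lee_addgt0Pr => e e0; rewrite -leeBlDr// -EFinB.
have [J aJ hJ] := sup_adherent e0 (has_sup_attains pI).
apply: (@le_trans _ _ J%:E); first by rewrite lee_fin ltW.
have [P [tau [Q [F [adm ->]]]]] := attains_payoff aJ.
apply: ereal_sup_ubound.
by exists default_measure_display, nat, P, tau, Q, F.
Qed.

Lemma value_le_vstar p : p \in `[0, 1] ->
  (value lam0 lam1 r kappa ut c p <= (vstar p)%:E)%E.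
Proof.
move=> pI; apply: ge_ereal_sup => J [d [Om [P [tau [Q [F [adm ->]]]]]]].
exact: payoff_le_vstar.
Qed.

End shifted.

Lemma valueE p : p \in `[0, 1] -> value lam0 lam1 r kappa ut c p = (vstar p)%:E.
Proof.
move=> pI; have [K K0 [hK hK']] := uc_ubar_bound.
by apply/eqP; rewrite eq_le (value_le_vstar K0 hK hK')// (vstar_le_value K0 hK hK').
Qed.

End model_payoffs.

Unset Implicit Arguments.
Set Strict Implicit.
Set Printing Implicit Defensive.

Theorem theorem1 (R : realType) (lam0 lam1 r kappa : R) (A : Type)
  (ut : A -> bool -> R) (c : R -> \bar R) :
  0 < lam0 -> 0 < lam1 -> 0 < r -> 0 < kappa ->
  (* u(p) = max_a E_p[ut a theta] : the maximum is attained *)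
  (forall p : R, p \in `[0, 1] ->
     exists a, forall b, expected_ut ut p b <= expected_ut ut p a) ->
  {within `[0, 1]%classic, continuous (u ut)} ->
  (* c : [0,1] -> [0, +oo], convex, finite and C^1 on the interior *)
  (forall x : R, x \in `[0, 1] -> (0 <= c x)%E) ->
  (forall x y t : R, x \in `[0, 1] -> y \in `[0, 1] -> t \in `[0, 1] ->
     (c (t * x + (1 - t) * y)%R <= t%:E * c x + (1 - t)%R%:E * c y)%E) ->
  (forall x : R, x \in `]0, 1[ -> c x \is a fin_num) ->
  (forall x : R, x \in `]0, 1[ -> derivable (fine \o c) x 1) ->
  {within `]0, 1[%classic, continuous (derive1 (fine \o c))} ->
  let v : R -> R := fun p => fine (value lam0 lam1 r kappa ut c p) in
  [/\ (forall p : R, p \in `[0, 1] ->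
         value lam0 lam1 r kappa ut c p = (v p)%:E),
      inV lam0 lam1 r ut v,
      solves_bellman lam0 lam1 r kappa ut c v &
      (forall w : R -> R, inV lam0 lam1 r ut w ->
         solves_bellman lam0 lam1 r kappa ut c w ->
         forall p : R, p \in `[0, 1] -> w p = v p)].
Proof.
move=> lam0_gt0 lam1_gt0 r_gt0 kappa_gt0 u_max _ c_ge0 c_convex c_fin c_derivable _ v.
have vE p : p \in `[0, 1] -> v p = vstar lam0 lam1 r ut kappa c p.
  by move=> pI; rewrite /v valueE.
have [meas [[M bounded] between]] :=
  inV_vstar lam0_gt0 lam1_gt0 r_gt0 u_max kappa_gt0 c_convex c_fin c_derivable.
(* [v] is known to agree with [vstar] only on the unit interval, which is all that the integrals in
   [inner] see. *)
have innerE q : inner kappa c v q = inner kappa c (vstar lam0 lam1 r ut kappa c) q.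
  rewrite /inner; congr (ereal_sup _); apply: eq_imagel => F _.
  by congr (_ - _ - _)%E; apply: eq_integral => x /set_mem /vE ->.
split.
- by move=> p pI; rewrite vE// valueE.
- split; last split.
  + by apply: eq_measurable_fun meas => x /set_mem /vE ->.
  + by exists M => p pI; rewrite vE// bounded.
  + by move=> p pI; rewrite vE// between.
- move=> p pI; rewrite vE// solves_bellman_vstar// /bellman_rhs.
  by congr (ereal_sup _); apply: eq_imagel => s _; rewrite innerE.
- by move=> w wV wS p pI; rewrite vE//; exact: solution_eq_vstar.
Qed.
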